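(* Let $d \ge 2$ be an integer, let $1 < p < d$ and $1 < q < \frac{pd}{d-p}$, and let $1 \le q_1 \le q$. Then for every $r \in \left[p\left(\frac{q}{d}+1\right), \frac{pd}{d-p}\right]$ there exists a constant $C>0$, independent of $u$, such that the following holds: for every $u \in C^1_c(\mathbb{R}^d)$ satisfying $$\int_{\mathbb{R}^d}|\nabla u|^p\,d\mathbf{x} \leq 1 \qquad\text{and}\qquad \sup_{\rho>0,\ \mathbf{z}\in\mathbb{R}^d}\rho^{\frac{d(q_1-q)}{q}}\int_{B_\rho(\mathbf{z})}|u|^{q_1}\,d\mathbf{x}\leq 1,$$ one has $$\int_{\mathbb{R}^d}|u|^r\,d\mathbf{x} \leq C.$$
   Context: $B_\rho(\mathbf{z}) = \{\mathbf{y}\in\mathbb{R}^d : |\mathbf{y}-\mathbf{z}|<\rho\}$ is the open ball. $C^1_c(\mathbb{R}^d)$ is the space of continuously differentiable real-valued functions on $\mathbb{R}^d$ with compact support. *)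

(* Defs.v *)
From HB Require Import structures.
From mathcomp Require Import all_boot all_order all_algebra.
From mathcomp Require Import all_classical all_reals all_analysis.
Set Implicit Arguments.
Unset Strict Implicit.
Unset Printing Implicit Defensive.
Import Order.TTheory GRing.Theory Num.Theory.
Import numFieldNormedType.Exports.
Local Open Scope classical_set_scope.
Local Open Scope ring_scope.

(* 'rV[T]_n carries the sigma-algebra generated by the coordinates, as
   n.-tuple T does.  For T = R it is the Borel sigma-algebra of R^n. *)
Section measurable_rV.
Context {d : measure_display} {T : measurableType d}.
Variable n : nat.

Definition rV_coord (i : 'I_n) (v : 'rV[T]_n) : T := v ord0 i.

Let rV_set0 : g_sigma_preimage rV_coord set0.
Proof. exact: sigma_algebra0. Qed.

Let rV_setC A : g_sigma_preimage rV_coord A -> g_sigma_preimage rV_coord (~` A).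
Proof. exact: sigma_algebraC. Qed.

Let rV_bigcup (F : (set 'rV[T]_n)^nat) :
  (forall i, g_sigma_preimage rV_coord (F i)) ->
  g_sigma_preimage rV_coord (\bigcup_i (F i)).
Proof. exact: sigma_algebra_bigcup. Qed.

HB.instance Definition _ := @isMeasurable.Build (measure_tuple_display d)
  'rV[T]_n (g_sigma_preimage rV_coord) rV_set0 rV_setC rV_bigcup.

End measurable_rV.

Lemma measurable_rV_coord d (T : measurableType d) n (i : 'I_n) :
  measurable_fun [set: 'rV[T]_n] (rV_coord i).
Proof.
move=> _ Y mY; rewrite setTI; apply: sub_sigma_algebra => /=.
rewrite -bigcup_seq/=; exists i => /=; first by rewrite mem_index_enum.
by exists Y => //; rewrite setTI.
Qed.

Lemma measurable_fun_rVP d1 d2 (T1 : measurableType d1) (T2 : measurableType d2)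
    n (f : T1 -> 'rV[T2]_n) :
  measurable_fun [set: T1] f <->
  forall i, measurable_fun [set: T1] (fun x => f x ord0 i).
Proof.
split=> [mf i|mf].
  apply: (@measurableT_comp _ _ _ _ _ _ (rV_coord i)) => //.
  exact: measurable_rV_coord.
move=> _ A mA; rewrite setTI.
suff : (g_sigma_preimage (@rV_coord _ T2 n)) `<=`
    [set B | measurable (f @^-1` B)] by apply.
apply: smallest_sub.
  split => /=.
  - by rewrite preimage_set0.
  - by move=> B mB; rewrite setTD preimage_setC; exact: measurableC.
  - by move=> F mF; rewrite preimage_bigcup; exact: bigcup_measurable.
rewrite -bigcup_seq => B [i _ [C mC <-]] /=.
by rewrite setTI -[X in measurable X]setTI; exact: mf.
Qed.

(* The library's sigma-finite instance on m1 \x m2 is not found by unification: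
   it is shadowed by the one for products of subprobabilities. *)
Lemma sigma_finite_product d1 d2 (T1 : measurableType d1)
    (T2 : measurableType d2) (R : realType)
    (m1 : {sigma_finite_measure set T1 -> \bar R})
    (m2 : {sigma_finite_measure set T2 -> \bar R}) :
  sigma_finite setT (m1 \x m2)%E.
Proof.
have /sigma_finiteP[F [TF ndF Foo]] := sigma_finiteT m1.
have /sigma_finiteP[G [TG ndG Goo]] := sigma_finiteT m2.
exists (fun n => F n `*` G n).
  rewrite -setXTT TF TG predeqE => -[x y]; split.
    move=> [/= [n _ Fnx] [k _ Gky]]; exists (maxn n k) => //; split.
    - by move: x Fnx; exact/subsetPset/ndF/leq_maxl.
    - by move: y Gky; exact/subsetPset/ndG/leq_maxr.
  by move=> [n _ []/= ? ?]; split; exists n.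
move=> k; have [? ?] := Foo k; have [? ?] := Goo k.
split; first exact: measurableX.
by rewrite product_measure1E// lte_mul_pinfty// ge0_fin_numE.
Qed.

Section lebesgue_rV.
Context {R : realType}.

Definition rV_cons n (p : measurableTypeR R * 'rV[R]_n) : 'rV[R]_n.+1 :=
  row_mx (const_mx p.1 : 'rV[R]_1) p.2.

Lemma rV_cons0 n (p : measurableTypeR R * 'rV[R]_n) :
  rV_cons p ord0 ord0 = p.1.
Proof.
have e : (ord0 : 'I_n.+1) = lshift n (ord0 : 'I_1) by exact: val_inj.
rewrite e; apply: etrans (row_mxEl _ _ _ _) _; exact: mxE.
Qed.

Lemma rV_consS n (p : measurableTypeR R * 'rV[R]_n) i :
  rV_cons p ord0 (lift ord0 i) = p.2 ord0 i.
Proof.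
have e : lift ord0 i = rshift 1 i by exact: val_inj.
by rewrite e; exact: row_mxEr.
Qed.

Lemma measurable_rV_cons n : measurable_fun setT (@rV_cons n).
Proof.
apply/measurable_fun_rVP => i.
have [j ->|->] := unliftP ord0 i.
- under eq_fun do rewrite rV_consS.
  apply: (@measurableT_comp _ _ _ _ _ _ (@rV_coord _ R n j) _ snd) => //.
  exact: measurable_rV_coord.
- under eq_fun do rewrite rV_cons0.
  exact: measurable_fst.
Qed.

Section step.
Variables (n : nat) (m : {sigma_finite_measure set 'rV[R]_n -> \bar R}).

Definition lebesgue_rVS : set 'rV[R]_n.+1 -> \bar R :=
  pushforward (lebesgue_measure \x m)%E (@rV_cons n).

Let lebesgue_rVS0 : lebesgue_rVS set0 = 0%E.
Proof. by rewrite /lebesgue_rVS /pushforward preimage_set0 measure0. Qed.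

Let lebesgue_rVS_ge0 A : (0 <= lebesgue_rVS A)%E.
Proof. by rewrite /lebesgue_rVS /pushforward measure_ge0. Qed.

Let lebesgue_rVS_sigma_additive : semi_sigma_additive lebesgue_rVS.
Proof.
have mc A : measurable A -> measurable (@rV_cons n @^-1` A).
  by move=> mA; rewrite -[X in measurable X]setTI; exact: measurable_rV_cons.
move=> F mF tF mUF; rewrite /lebesgue_rVS /pushforward preimage_bigcup.
apply: measure_semi_sigma_additive.
- by move=> k; exact: mc.
- apply/trivIsetP => /= i j _ _ ij; rewrite -preimage_setI.
  by move/trivIsetP : tF => /(_ _ _ _ _ ij) ->//; rewrite preimage_set0.
- by rewrite -preimage_bigcup; exact: mc.
Qed.

HB.instance Definition _ := isMeasure.Build _ _ _ lebesgue_rVS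
  lebesgue_rVS0 lebesgue_rVS_ge0 lebesgue_rVS_sigma_additive.

Let rV_behead (v : 'rV[R]_n.+1) : 'rV[R]_n := \row_j v ord0 (lift ord0 j).

Let rV_uncons (v : 'rV[R]_n.+1) : measurableTypeR R * 'rV[R]_n :=
  (v ord0 ord0, rV_behead v).

Let rV_consK p : rV_uncons (rV_cons p) = p.
Proof.
case: p => x v; rewrite /rV_uncons rV_cons0; congr pair.
by apply/rowP => i; rewrite mxE rV_consS.
Qed.

Let measurable_rV_uncons : measurable_fun setT rV_uncons.
Proof.
apply/measurable_fun_pairP; split => /=.
  exact: (@measurable_rV_coord _ R n.+1 ord0).
apply/measurable_fun_rVP => i /=.
under eq_fun do rewrite mxE.
exact: (@measurable_rV_coord _ R n.+1 (lift ord0 i)).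
Qed.

Let lebesgue_rVS_sigma_finite : sigma_finite setT lebesgue_rVS.
Proof.
have [F FT Foo] := sigma_finite_product lebesgue_measure m.
exists (fun k => rV_uncons @^-1` F k).
  by rewrite -preimage_bigcup -FT preimage_setT.
move=> k; have [mFk Fk] := Foo k; split.
  by rewrite -[X in measurable X]setTI; exact: measurable_rV_uncons.
rewrite /lebesgue_rVS /pushforward -comp_preimage.
by rewrite (_ : _ \o _ = id) ?preimage_id//; apply/funext => p; exact: rV_consK.
Qed.

HB.instance Definition _ := @Measure_isSigmaFinite.Build _ _ _ lebesgue_rVS
  lebesgue_rVS_sigma_finite.

End step.

(* Lebesgue measure on R^n: the n-fold product of the one-dimensional one. *)
Fixpoint lebesgue_rV (n : nat) : {sigma_finite_measure set 'rV[R]_n -> \bar R} :=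
  match n with
  | 0 => \d_(0 : 'rV[R]_0)
  | k.+1 => lebesgue_rVS (lebesgue_rV k)
  end.

Lemma lebesgue_rV_box n (A : 'I_n -> set R) :
  (forall i, measurable (A i)) ->
  lebesgue_rV n [set v | forall i, A i (v ord0 i)] =
  (\prod_(i < n) lebesgue_measure (A i))%E.
Proof.
elim: n A => [|n IHn] A mA.
  by rewrite big_ord0 /= diracE mem_set// => -[].
set B := [set v : 'rV[R]_n | forall i, A (lift ord0 i) (v ord0 i)].
have mB : measurable B.
  rewrite (_ : B = \bigcap_(i in [set: 'I_n])
      (rV_coord i @^-1` A (lift ord0 i))); last first.
    by apply/seteqP; split => [v Av i _|v Av i]; exact: Av.
  apply: fin_bigcap_measurable => // i _.
  by rewrite -[X in measurable X]setTI; exact: measurable_rV_coord.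
rewrite big_ord_recl -IHn//.
rewrite -(product_measure1E lebesgue_measure (lebesgue_rV n) (mA ord0) mB).
apply: (congr1 (lebesgue_measure \x lebesgue_rV n)%E).
apply/seteqP; split => [p /= Ap|p /= [Ap1 Ap2] i].
  split; first by have := Ap ord0; rewrite rV_cons0.
  by move=> i; have := Ap (lift ord0 i); rewrite rV_consS.
by have [j ->|->] := unliftP ord0 i; rewrite (rV_consS, rV_cons0).
Qed.

End lebesgue_rV.

Section euclidean.
Context {R : realType} {n : nat}.

(* The library norm `|v| on 'rV[R]_n is the sup norm; it defines the same
   topology and the same notion of differentiability. *)
Definition enorm (v : 'rV[R]_n) : R := Num.sqrt (\sum_(i < n) v ord0 i ^+ 2).

Definition eball (z : 'rV[R]_n) (rho : R) : set 'rV[R]_n :=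
  [set y | enorm (y - z) < rho].

Definition grad (u : 'rV[R]_n -> R) (x : 'rV[R]_n) : 'rV[R]_n :=
  \row_(i < n) 'D_(delta_mx ord0 i) u x.

Definition C1c (u : 'rV[R]_n -> R) : Prop :=
  [/\ forall x, differentiable u x,
      continuous (grad u) &
      compact (closure [set x | u x != 0])].

End euclidean.

(* Main.v *)
Require Import Defs.
From mathcomp Require Import all_boot all_order all_algebra.
From mathcomp Require Import all_classical all_reals all_analysis.
From mathcomp Require Import measurable_realfun.
From mathcomp Require Import ring lra.
Set Implicit Arguments.
Unset Strict Implicit.
Unset Printing Implicit Defensive.
Import Order.TTheory GRing.Theory Num.Theory.
Import numFieldNormedType.Exports.
Local Open Scope classical_set_scope.
Local Open Scope ring_scope.

(** The classical argument is pointwise: u(x) differs from its mean over a cube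
   of size t around x by at most C t M(x), with M the maximal function of
   |grad u|, and the Morrey condition bounds that mean by C t^(-d/q).  Choosing
   t to balance the two terms gives |u|^r <= C M^p at r = p (1 + q/d), and the
   maximal theorem in L^p concludes.

   Here the maximal function is dyadic and never appears as a function.  A cube
   containing the support of u is bisected again and again, always across a
   longest side, so that all boxes met stay balanced: their sides differ by a
   factor at most 2, and the volume is comparable to D^d for D the sum of the
   sides.

   - Cutting a box Q changes the mean of u by at most (D - D') times the mean of
     |grad u| over Q, where D' is the sum of the sides of a half
     ([mean_halve_dist]).  The sums D telescope, so along a chain of halves the
     mean of u moves by at most (D_start - D_end) m, where m is the largest mean
     of |grad u| met on the way.

   - Put r = p (1 + 1/b).  The range allowed for r says exactly that
     d/p - 1 <= b <= d/q, and on every balanced box the mean of u is O(D^(-b)).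
     For D >= 1 this is the Morrey condition and Jensen's inequality; for
     D <= 1 it follows from the energy bound by climbing up to a box of size one
     ([mean_bound_small_scale]), and this is what reaches the Sobolev exponent.

   - Burkholder's function [doob p m s], where s is the mean of |grad u| and m
     its running maximum, is affine in s and decreases when m is updated; its
     integral therefore decreases along the bisection, which is Doob's maximal
     inequality without a maximal function ([bellman_induction]).  On the final
     boxes |u|^r is at most C m^p up to a small error ([powR_le_of_scales]), and
     m^p is controlled by [doob p m s] and s^p ([powR_le_doob]).

   The starting value m = T^(-(1 + b)), for T the sum of the sides of the initial
   cube, contributes a bounded amount however large the cube is, because
   d <= p (1 + b). *)

(** * Inequalities between real powers *)

Section power_inequalities.
Context {R : realType}.
Implicit Types p x y m s : R.

(** Weighted Young inequality.  It is used both for Doob's function and, read as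
   the supporting line of [y `^ p] at [x], for Jensen's inequality. *)
Lemma powR_young p x y : 1 <= p -> 0 <= x -> 0 <= y ->
  p * x `^ (p - 1) * y <= (p - 1) * x `^ p + y `^ p.
Proof.
move=> p1 x0 y0; have p0 : 0 < p by lra.
have := p1; rewrite le_eqVlt => /predU1P[<-|p1'].
  by rewrite subrr powRr0 !powRr1// mul0r add0r !mul1r.
have q0 : 0 < p / (p - 1) by rewrite divr_gt0// subr_gt0.
have pn0 : p - 1 != 0 by rewrite subr_eq0 gt_eqF.
have e : p^-1 + (p / (p - 1))^-1 = 1 by field; rewrite pn0 gt_eqF.
have := conjugate_powR y0 (powR_ge0 x (p - 1)) p0 q0 e.
rewrite -powRrM [_ * (p / _)]mulrC divfK// -(ler_pM2l p0).
congr (_ <= _); first by ring.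
by field; rewrite pn0 gt_eqF.
Qed.

Lemma ler_powR_base p x y : 0 <= p -> 0 <= x -> x <= y -> x `^ p <= y `^ p.
Proof.
by move=> p0 x0 xy; rewrite ge0_ler_powR ?nnegrE// (le_trans x0 xy).
Qed.

Lemma powR_split p x : 0 <= x -> 0 < p -> x `^ (p - 1) * x = x `^ p.
Proof. by move=> x0 p0; rewrite mulrC mulr_powRB1. Qed.

Lemma le_powRD_max p x y : 0 <= p -> 0 <= x -> 0 <= y ->
  (x + y) `^ p <= 2 `^ p * (x `^ p + y `^ p).
Proof.
move=> p0; wlog xy : x y / x <= y => [H x0 y0|x0 y0].
  have [xy|/ltW yx] := leP x y; first exact: H.
  by rewrite addrC [_ `^ p + _]addrC; exact: H.
apply: (@le_trans _ _ ((2 * y) `^ p)).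
  by rewrite ge0_ler_powR ?nnegrE//; lra.
by rewrite powRM// ler_wpM2l ?powR_ge0// lerDr powR_ge0.
Qed.

(** The convex function [t |-> t `^ (- a)] lies above its tangent line at [x];
   after division by [x `^ (- a)] this is [1 - a * ln s <= expR (- a * ln s)] and
   [ln s <= s - 1], with [s = y / x]. *)
Lemma powRN_tangent a x y : 0 <= a -> 0 < x -> 0 < y ->
  x `^ (- a) + a * x `^ (- (a + 1)) * (x - y) <= y `^ (- a).
Proof.
move=> a0 x0 y0.
have -> : y `^ (- a) = x `^ (- a) * (y / x) `^ (- a).
  by rewrite -powRM// ?divr_ge0 ?ltW// mulrC divfK// gt_eqF.
have -> : x `^ (- (a + 1)) = x `^ (- a) * x^-1.
  rewrite opprD powRD; last by rewrite (gt_eqF x0) implybT.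
  by rewrite powR_inv1 ?ltW.
have -> : x `^ (- a) + a * (x `^ (- a) / x) * (x - y) =
          x `^ (- a) * (1 - a * (y / x - 1)).
  by field; rewrite gt_eqF.
rewrite ler_wpM2l ?powR_ge0//.
have yx0 : 0 < y / x by rewrite divr_gt0.
rewrite /powR gt_eqF//.
apply: le_trans (expR_ge1Dx _).
rewrite lerD2l mulNr lerN2 ler_wpM2l//.
by rewrite -[X in ln X](subrK 1) addrC le_ln1Dx//; lra.
Qed.

End power_inequalities.

Section maximal_potential.
Context {R : realType}.
Implicit Types p m s : R.

(** Burkholder's function for Doob's maximal inequality in L^p: [m] is the
   running maximum of the averages and [s] the current one. *)
Definition doob p m s : R := (p - 1) * m `^ p - p * m `^ (p - 1) * s.

(** When [m < s] the left side is [- s `^ p], and the claim is Young's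
   inequality. *)
Lemma doob_update p m s : 1 <= p -> 0 <= m -> 0 <= s ->
  doob p (Num.max m s) s <= doob p m s.
Proof.
move=> p1 m0 s0; rewrite /doob; have [sm|ms] := leP s m.
  by [].
rewrite -mulrA powR_split//; last by lra.
have := powR_young p1 m0 s0; lra.
Qed.

Lemma doob_le p m s : 1 <= p -> 0 <= m -> 0 <= s ->
  doob p m s <= (p - 1) * m `^ p.
Proof.
move=> p1 m0 s0; rewrite /doob gerBl// mulr_ge0// mulr_ge0 ?powR_ge0//; lra.
Qed.

(** Young's inequality at [c * m] and [c^(1-p) * s] with [c^p = 1/2] absorbs half
   of the main term of [doob p m s]. *)
Lemma powR_le_doob p m s : 1 < p -> 0 <= m -> 0 <= s ->
  m `^ p <= 2 / (p - 1) * (doob p m s + 2 `^ (p - 1) * s `^ p).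
Proof.
move=> p1 m0 s0; have p0 : 0 < p by lra.
pose c : R := 2^-1 `^ p^-1.
have c0 : 0 < c by rewrite powR_gt0.
have cp : c `^ p = 2^-1.
  by rewrite -powRrM mulVf ?gt_eqF// powRr1// invr_ge0.
have d0 : 0 < c `^ (p - 1) by exact: powR_gt0.
have /= := @powR_young R p (c * m) (s / c `^ (p - 1)) (ltW p1)
  (mulr_ge0 (ltW c0) m0) (divr_ge0 s0 (ltW d0)).
rewrite !powRM ?invr_ge0 ?powR_ge0// ?(ltW c0)// cp.
have -> : ((c `^ (p - 1))^-1) `^ p = 2 `^ (p - 1).
  rewrite -powRN -powRrM [- _ * _]mulrC mulrN -mulrN powRrM cp.
  by rewrite -powR_inv1// -powRrM mulN1r opprK.
have -> : p * (c `^ (p - 1) * m `^ (p - 1)) * (s / c `^ (p - 1)) =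
          p * m `^ (p - 1) * s by field; rewrite gt_eqF.
move=> h; rewrite -ler_pdivrMl ?divr_gt0 ?subr_gt0// invf_div /doob.
lra.
Qed.

End maximal_potential.

(** * Borel sets and translations in R^n *)

Section measurable_rV_sets.
Context {R : realType}.
Variable n : nat.
Implicit Types (B : 'I_n -> set R) (U : set 'rV[R]_n).

Definition rV_rect B : set 'rV[R]_n := [set v | forall i, B i (v ord0 i)].

Lemma measurable_rV_rect B :
  (forall i, measurable (B i)) -> measurable (rV_rect B).
Proof.
move=> mB; rewrite (_ : rV_rect B = \bigcap_(i in [set: 'I_n])
    (rV_coord i @^-1` B i)); last first.
  by apply/seteqP; split => [v Bv i _|v Bv i]; exact: Bv.
apply: fin_bigcap_measurable => // i _.
by rewrite -[X in measurable X]setTI; exact: measurable_rV_coord.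
Qed.

(** An open set is the union of the cubes with rational data it contains. *)
Lemma open_measurable_rV U : open U -> measurable U.
Proof.
move=> oU.
pose r (c : 'rV[rat]_n * rat) := rV_rect (fun i =>
  `]ratr (c.1 ord0 i) - ratr c.2 : R, ratr (c.1 ord0 i) + ratr c.2[%classic).
pose F c := [set v | r c v /\ r c `<=` U].
suff -> : U = \bigcup_c F c.
  apply: countable_bigcupT_measurable; first exact: countableP.
  move=> c; have [cU|ncU] := pselect (r c `<=` U).
    rewrite (_ : F c = r c); first by apply: measurable_rV_rect => i.
    by apply/seteqP; split => [v []|v].
  rewrite (_ : F c = set0); first exact: measurable0.
  by apply/seteqP; split => [v []|v].
apply/seteqP; split => [x Ux|x [c _ [rx]]]; last exact.
have /nbhs_ballP [e /= e0 xeU] := open_nbhs_nbhs (conj oU Ux).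
have [q] := @rat_in_itvoo R 0 (e / 2) (divr_gt0 e0 (ltr0Sn _ _)).
rewrite in_itv /= => /andP[q0 qe].
have /choice[c cP] i : exists c : rat,
    x ord0 i - ratr q < ratr c < x ord0 i + ratr q.
  have [c] : exists c : rat, ratr c \in `]x ord0 i - ratr q, x ord0 i + ratr q[.
    by apply: rat_in_itvoo; lra.
  by rewrite in_itv; exists c.
exists (\row_i c i, q) => //; split => [i|y ry].
  by have := cP i; rewrite /= in_itv /= mxE => ?; lra.
apply: xeU; split => // i j; rewrite ord1.
have := cP j; have := ry j; rewrite /= in_itv /= mxE /ball /= ltr_norml => ? ?.
lra.
Qed.

Lemma continuous_measurable_rV (f : 'rV[R]_n -> R) :
  continuous f -> measurable_fun setT f.
Proof.
move=> cf; apply: (measurability _ (RGenOpens.measurableE R)).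
move=> _ [_ [a [b ->]] <-]; rewrite setTI; apply: open_measurable_rV.
by move/continuousP : cf; apply; exact: interval_open.
Qed.

End measurable_rV_sets.

Section translation.
Context {R : realType}.

Let lebesgue_rV_rect n (B : 'I_n -> set R) : (forall i, measurable (B i)) ->
  lebesgue_rV n (rV_rect B) = (\prod_(i < n) lebesgue_measure (B i))%E.
Proof. exact: lebesgue_rV_box. Qed.

Lemma lebesgue_measure_shift (c : R) (A : set R) : measurable A ->
  lebesgue_measure ((fun x => x + c) @^-1` A) = lebesgue_measure A.
Proof.
move=> mA.
have mf : measurable_fun setT (fun x : measurableTypeR R => x + c : measurableTypeR R).
  by apply: measurable_funD.
apply/esym/(@lebesgue_measure_unique _ (pushforward lebesgue_measure
  (fun x : measurableTypeR R => x + c : measurableTypeR R))) => //= _ [[a b]] _ <-.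
rewrite /pushforward /= (_ : _ @^-1` _ = `]a - c, b - c]%classic); last first.
  by apply/seteqP; split => x /=; rewrite !in_itv /= => ?; lra.
rewrite !lebesgue_measure_itv /= !lte_fin ltrD2r.
by case: ifP => // _; rewrite -!EFinB; congr EFin; ring.
Qed.

(** Both sides are measures in [A]; they agree on the product sets, which are
   stable under intersection and generate the sigma-algebra. *)
Lemma lebesgue_rV_shift n (c : 'rV[R]_n) (A : set 'rV[R]_n) : measurable A ->
  lebesgue_rV n ((fun x => x + c) @^-1` A) = lebesgue_rV n A.
Proof.
move=> mA.
have mf : measurable_fun setT (fun x : 'rV[R]_n => x + c).
  apply/measurable_fun_rVP => i; under eq_fun do rewrite mxE.
  by apply: measurable_funD => //; exact: measurable_rV_coord.
pose G := [set A | exists2 B : 'I_n -> set R,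
  forall i, measurable (B i) & A = rV_rect B].
apply/esym/(@measure_unique _ _ _ G (fun k => rV_rect (fun=> `]- k%:R, k%:R[%classic))
  _ _ _ _ _ (pushforward (lebesgue_rV n) (fun x : 'rV[R]_n => x + c))) => //.
- apply/seteqP; split => B; last first.
    move=> GB; apply: (smallest_sub (sigma_algebra_measurable _) _ GB).
    by move=> _ [D mD ->]; exact: measurable_rV_rect.
  apply: smallest_sub; first exact: smallest_sigma_algebra.
  rewrite -bigcup_seq => D [i _ [E mE <-]] /=.
  apply: sub_sigma_algebra; exists (fun j => if j == i then E else setT).
    by move=> j; case: ifP.
  rewrite setTI; apply/seteqP; split => [v Ev j|v Ev].
    by case: eqP => // ->.
  by have := Ev i; rewrite eqxx.
- move=> _ _ [B mB ->] [D mD ->]; exists (fun i => B i `&` D i).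
    by move=> i; exact: measurableI.
  apply/seteqP; split => v; first by move=> [Bv Dv] i.
  by move=> BDv; split=> i; case: (BDv i).
- by move=> k; exists (fun=> `]- k%:R, k%:R[%classic).
- apply/seteqP; split => // v _; exists (Num.truncn (\sum_i `|v ord0 i|)).+1 => // i.
  rewrite /= in_itv /= -ltr_norml.
  apply: le_lt_trans (truncnS_gt _).
  by rewrite (bigD1 i)//= lerDl sumr_ge0.
- move=> _ [B mB ->].
  change (lebesgue_rV n (rV_rect B) =
    lebesgue_rV n ((fun x => x + c) @^-1` rV_rect B)).
  rewrite lebesgue_rV_rect//.
  rewrite (_ : _ @^-1` _ =
    rV_rect (fun i => (fun x => x + c ord0 i) @^-1` B i)); last first.
    by apply/seteqP; split => v Bv i; have := Bv i; rewrite /= mxE.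
  rewrite lebesgue_rV_rect => [|i].
    by apply: eq_bigr => i _; rewrite lebesgue_measure_shift.
  have mc : measurable_fun setT (fun x : R => x + c ord0 i).
    by apply: measurable_funD.
  by rewrite -[X in measurable X]setTI; exact: mc.
- move=> k; set B := rV_rect _; change (lebesgue_rV n B < +oo)%E.
  rewrite lebesgue_rV_rect//.
  rewrite -ge0_fin_numE ?prode_ge0//.
  by apply: prode_fin_num => i _; rewrite lebesgue_measure_itv /=; case: ifP.
Qed.

Lemma Rintegral_rV_shift n (c : 'rV[R]_n) (D : set 'rV[R]_n) (f : 'rV[R]_n -> R) :
  measurable D -> measurable_fun setT f ->
  (lebesgue_rV n).-integrable ((fun x => x + c) @^-1` D) (fun x => (f (x + c))%:E) ->
  \int[lebesgue_rV n]_(x in (fun x => x + c) @^-1` D) f (x + c) =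
  \int[lebesgue_rV n]_(x in D) f x.
Proof.
move=> mD mf fi.
have ms : measurable_fun setT (fun x : 'rV[R]_n => x + c).
  apply/measurable_fun_rVP => i; under eq_fun do rewrite mxE.
  by apply: measurable_funD => //; exact: measurable_rV_coord.
rewrite /Rintegral; congr fine.
have mEf : measurable_fun setT (EFin \o f) by exact/measurable_EFinP.
rewrite -(integral_pushforward ms mEf fi mD).
by apply: eq_measure_integral => A mA _; exact: lebesgue_rV_shift.
Qed.

End translation.

(** * Means over boxes *)

Section boxes.
Context {R : realType} {n : nat}.
Implicit Types (a l x : 'rV[R]_n) (f g : 'rV[R]_n -> R) (i : 'I_n).

Local Notation mu := (lebesgue_rV n).

Definition box a l : set 'rV[R]_n :=
  [set x | forall i, a ord0 i <= x ord0 i < a ord0 i + l ord0 i].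

Definition volume l : R := \prod_i l ord0 i.

(** The size of a box is measured by the sum of its sides: it bounds the
   diameter, and it drops by exactly the length of the cut when a side is halved,
   which makes the oscillation estimates telescope. *)
Definition side_sum l : R := \sum_i l ord0 i.

Definition sides_gt0 l := forall i, 0 < l ord0 i.

Definition boxint a l f : R := \int[mu]_(x in box a l) f x.

Definition mean a l f : R := (volume l)^-1 * boxint a l f.

Definition dir i : 'rV[R]_n := delta_mx ord0 i.

Definition halve i l : 'rV[R]_n :=
  \row_j (if j == i then l ord0 j / 2 else l ord0 j).

Lemma dirE i j : dir i ord0 j = (j == i)%:R.
Proof. by rewrite /dir mxE eqxx. Qed.

Lemma boxE a l :
  box a l = rV_rect (fun i => `[a ord0 i, a ord0 i + l ord0 i[%classic).
Proof.
by apply/seteqP; split => x h i; have := h i; rewrite /= in_itv.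
Qed.

Lemma measurable_box a l : measurable (box a l).
Proof. by rewrite boxE; exact: measurable_rV_rect. Qed.
Hint Resolve measurable_box : core.

Lemma lebesgue_box a l : sides_gt0 l -> mu (box a l) = (volume l)%:E.
Proof.
move=> l0; rewrite boxE; apply: etrans (lebesgue_rV_box _) _ => //.
rewrite /volume -prodEFin; apply: eq_bigr => i _.
rewrite lebesgue_measure_itv /= lte_fin ltrDl l0 -EFinD.
by congr EFin; ring.
Qed.

Lemma volume_gt0 l : sides_gt0 l -> 0 < volume l.
Proof. by move=> l0; apply: prodr_gt0. Qed.

Lemma box_in_compact a l :
  exists2 K : set 'rV[R]_n, compact K & box a l `<=` K.
Proof.
exists (rV_rect (fun i => `[a ord0 i, a ord0 i + l ord0 i]%classic)).
  by apply: (@rV_compact R^o _ (fun i =>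
    `[a ord0 i, a ord0 i + l ord0 i]%classic)) => i; exact: segment_compact.
move=> x h i; have /andP[h1 /ltW h2] := h i.
by rewrite /= in_itv /= h1.
Qed.

Lemma integrable_box a l f : sides_gt0 l -> continuous f ->
  mu.-integrable (box a l) (EFin \o f).
Proof.
move=> l0 cf; have muf : (mu (box a l) < +oo)%E by rewrite lebesgue_box// ltry.
apply: measurable_bounded_integrable => //.
- by apply: measurable_funTS; exact: continuous_measurable_rV.
have [K cK aK] := box_in_compact a l.
have /compact_bounded [M [Mr hM]] : compact (f @` K).
  by apply: continuous_compact => //; exact: continuous_subspaceT.
by exists M; split=> // y My x /aK Kx; apply: hM => //; exists x.
Qed.

Lemma boxintD a l f g : sides_gt0 l -> continuous f -> continuous g ->
  boxint a l (fun x => f x + g x) = boxint a l f + boxint a l g.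
Proof. by move=> l0 cf cg; apply: RintegralD => //; exact: integrable_box. Qed.

Lemma boxintB a l f g : sides_gt0 l -> continuous f -> continuous g ->
  boxint a l (fun x => f x - g x) = boxint a l f - boxint a l g.
Proof. by move=> l0 cf cg; apply: RintegralB => //; exact: integrable_box. Qed.

Lemma boxintZ a l (k : R) f : sides_gt0 l -> continuous f ->
  boxint a l (fun x => k * f x) = k * boxint a l f.
Proof. by move=> l0 cf; apply: RintegralZl => //; exact: integrable_box. Qed.

Lemma boxint_cst a l (k : R) : sides_gt0 l ->
  boxint a l (fun=> k) = k * volume l.
Proof.
move=> l0; rewrite -[volume l]/(fine (volume l)%:E) -(lebesgue_box a l0).
by rewrite -Rintegral_cst.
Qed.

Lemma le_boxint a l f g : sides_gt0 l -> continuous f -> continuous g ->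
  (forall x, box a l x -> f x <= g x) -> boxint a l f <= boxint a l g.
Proof. by move=> l0 cf cg; apply: le_Rintegral => //; exact: integrable_box. Qed.

Lemma normr_boxint a l f : sides_gt0 l -> continuous f ->
  `|boxint a l f| <= boxint a l (fun x => `|f x|).
Proof. by move=> l0 cf; apply: le_normr_Rintegral => //; exact: integrable_box. Qed.

Lemma boxint_ge0 a l f : (forall x, 0 <= f x) -> 0 <= boxint a l f.
Proof. by move=> f0; apply: Rintegral_ge0. Qed.

Lemma boxint_EFin a l f : sides_gt0 l -> continuous f ->
  (boxint a l f)%:E = (\int[mu]_(x in box a l) (f x)%:E)%E.
Proof.
move=> l0 cf; rewrite /boxint /Rintegral fineK//.
by apply: integrable_fin_num => //; exact: integrable_box.
Qed.

Lemma boxint_subset a l b m f : sides_gt0 l -> sides_gt0 m ->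
  continuous f -> (forall x, 0 <= f x) ->
  box a l `<=` box b m -> boxint a l f <= boxint b m f.
Proof.
move=> l0 m0 cf f0 sub; rewrite -lee_fin !boxint_EFin//.
apply: ge0_subset_integral => //.
- by apply/measurable_EFinP/measurable_funTS; exact: continuous_measurable_rV.
- by move=> x _; rewrite lee_fin.
Qed.

Lemma mean_cst a l (k : R) : sides_gt0 l -> mean a l (fun=> k) = k.
Proof.
by move=> l0; rewrite /mean boxint_cst// mulrC mulfK// gt_eqF// volume_gt0.
Qed.

Lemma le_mean a l f g : sides_gt0 l -> continuous f -> continuous g ->
  (forall x, box a l x -> f x <= g x) -> mean a l f <= mean a l g.
Proof.
move=> l0 cf cg fg; rewrite ler_wpM2l//; last exact: le_boxint.
by rewrite invr_ge0 ltW// volume_gt0.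
Qed.

Lemma meanD a l f g : sides_gt0 l -> continuous f -> continuous g ->
  mean a l (fun x => f x + g x) = mean a l f + mean a l g.
Proof. by move=> l0 cf cg; rewrite /mean boxintD// mulrDr. Qed.

Lemma meanZ a l (k : R) f : sides_gt0 l -> continuous f ->
  mean a l (fun x => k * f x) = k * mean a l f.
Proof. by move=> l0 cf; rewrite /mean boxintZ// mulrCA. Qed.

Lemma volume_mean a l f : sides_gt0 l -> volume l * mean a l f = boxint a l f.
Proof. by move=> l0; rewrite mulrA divff ?mul1r// gt_eqF// volume_gt0. Qed.

Lemma mean_ge0 a l f : sides_gt0 l -> (forall x, 0 <= f x) -> 0 <= mean a l f.
Proof.
by move=> l0 f0; rewrite mulr_ge0 ?invr_ge0 ?boxint_ge0// ltW// volume_gt0.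
Qed.

Lemma boxint_shift a l f (c : 'rV[R]_n) : sides_gt0 l -> continuous f ->
  boxint (a + c) l f = boxint a l (fun x => f (x + c)).
Proof.
move=> l0 cf.
have e : (fun x => x + c) @^-1` box (a + c) l = box a l.
  by apply/seteqP; split => x h i; have := h i; rewrite /= !mxE => ?; lra.
have cfc : continuous (fun x => f (x + c)).
  move=> x; apply: continuous_comp; last exact: cf.
  by apply: continuousD; [exact: cvg_id|exact: cst_continuous].
rewrite /boxint -(Rintegral_rV_shift (c := c))//.
- by rewrite e.
- exact: continuous_measurable_rV.
- by rewrite e; exact: (integrable_box a l0 cfc).
Qed.

Section halving.
Variables (a l : 'rV[R]_n) (i : 'I_n).
Hypothesis l0 : sides_gt0 l.

Let h := l ord0 i / 2.
Let b := a + h *: dir i.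

Let bE j : b ord0 j = if j == i then a ord0 j + h else a ord0 j.
Proof. by rewrite /b !mxE eqxx; case: eqP => _; rewrite ?mulr1 ?mulr0 ?addr0. Qed.

Let halveE j : halve i l ord0 j = if j == i then l ord0 j / 2 else l ord0 j.
Proof. by rewrite mxE. Qed.

Lemma halve_gt0 : sides_gt0 (halve i l).
Proof. by move=> j; rewrite mxE; case: ifP => _; rewrite ?divr_gt0. Qed.

Lemma volume_halve : volume (halve i l) = volume l / 2.
Proof.
rewrite /volume (bigD1 i)//= [in RHS](bigD1 i)//= mxE eqxx mulrAC; congr (_ * _ / _).
by apply: eq_bigr => j /negbTE ji; rewrite mxE ji.
Qed.

Lemma side_sum_halve : side_sum (halve i l) = side_sum l - l ord0 i / 2.
Proof.
rewrite /side_sum (bigD1 i)//= [in RHS](bigD1 i)//= mxE eqxx.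
under eq_bigr => j /negbTE ji do rewrite mxE ji.
by field.
Qed.

Lemma box_halve : box a l = box a (halve i l) `|` box b (halve i l).
Proof.
apply/seteqP; split => [x xQ|x [] xQ j]; last 2 first.
- by have := xQ j; have := l0 j; rewrite halveE; case: eqP => [->|_] ? ?; lra.
- by have := xQ j; have := l0 j; rewrite bE halveE /h; case: eqP => [->|_] ? ?; lra.
have [xi|xi] := ltP (x ord0 i) (a ord0 i + h); [left|right] => j.
- by have := xQ j; rewrite halveE; move: xi; rewrite /h; case: eqP => [->|_] ? ?; lra.
- by have := xQ j; rewrite bE halveE; move: xi; rewrite /h; case: eqP => [->|_] ? ?; lra.
Qed.

Lemma box_halve_disjoint : [disjoint box a (halve i l) & box b (halve i l)].
Proof.
apply/disj_setPRL => x h1 h2.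
have := h1 i; have := h2 i; rewrite bE halveE eqxx /h => ? ?; lra.
Qed.

Lemma boxint_halve f : continuous f ->
  boxint a l f = boxint a (halve i l) f + boxint b (halve i l) f.
Proof.
move=> cf; rewrite /boxint {1}box_halve Rintegral_setU//.
  by rewrite -box_halve; exact: integrable_box.
exact: box_halve_disjoint.
Qed.

Lemma mean_halve f : continuous f ->
  mean a l f = (mean a (halve i l) f + mean b (halve i l) f) / 2.
Proof.
move=> cf; rewrite /mean volume_halve boxint_halve// invf_div.
by field; rewrite gt_eqF// volume_gt0.
Qed.

End halving.
End boxes.

(** * Oscillation of the mean under bisection *)

Section oscillation.
Context {R : realType} {n : nat}.
Implicit Types (a l x : 'rV[R]_n) (f g u : 'rV[R]_n -> R) (i : 'I_n).

Lemma compact_unif_continuous (K : set 'rV[R]_n) f (e : R) :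
  compact K -> continuous f -> 0 < e ->
  exists2 eta, 0 < eta &
    forall x y, K x -> `|y - x| < eta -> `|f y - f x| < e.
Proof.
move=> /compact_near_coveringP cK cf e0.
have /cK H : forall x, K x -> \forall x' \near x & eta \near (0 : R)^'+,
    forall y, `|y - x'| < eta -> `|f y - f x'| < e.
  move=> x Kx; have e20 : 0 < e / 2 by rewrite divr_gt0.
  have /cvgrPdist_lt/(_ _ e20)/nbhs_ballP[d /= d0 hd] := cf x.
  have d20 : 0 < d / 2 by rewrite divr_gt0.
  exists (ball x (d / 2), [set t : R | t < d / 2]).
    split; first exact: nbhsx_ballx.
    exact: nbhs_right_lt.
  move=> [x' eta] /= [xx' etad] y yx'.
  have h1 : `|f x - f x'| < e / 2.
    by apply: hd; apply: le_ball xx'; lra.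
  have h2 : `|f x - f y| < e / 2.
    apply: hd; rewrite -ball_normE /=.
    rewrite -ball_normE /= in xx'.
    rewrite (splitr d) (_ : x - y = (x - x') - (y - x')); last first.
      by rewrite opprB addrA subrK.
    by apply: le_lt_trans (ler_normB _ _) _; rewrite ltrD// (lt_trans yx').
  rewrite (_ : f y - f x' = (f x - f x') - (f x - f y)); last by ring.
  by apply: le_lt_trans (ler_normB _ _) _; rewrite (splitr e) ltrD.
have /filter_ex [eta [eta0 heta]] : \forall eta \near (0 : R)^'+, 0 < eta /\
    K `<=` [set x' | forall y, `|y - x'| < eta -> `|f y - f x'| < e].
  by apply: filterI; [exact: nbhs_right_gt|exact: H].
by exists eta => // x y Kx; exact: heta.
Qed.

Lemma norm_dir_le i (t : R) : `|t *: dir i : 'rV[R]_n| <= `|t|.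
Proof.
rewrite mx_normZ -[leRHS]mulr1 ler_wpM2l//.
rewrite [X in X <= _]/Num.norm /= mx_normrE; apply/bigmax_leP; split => // -[j k] _ /=.
by rewrite ord1 dirE; case: eqP => _; rewrite ?normr1 ?normr0.
Qed.

Lemma is_derive_along u x i (t : R) : differentiable u (t *: dir i + x) ->
  is_derive t 1 (fun s => u (s *: dir i + x)) ('D_(dir i) u (t *: dir i + x)).
Proof.
move=> du; have dv := @diff_derivable _ _ _ u _ (dir i) du.
have e : (fun h : R => h^-1 *: (((fun s => u (s *: dir i + x)) \o shift t) (h *: 1) -
    u (t *: dir i + x))) =
  (fun h : R => h^-1 *: ((u \o shift (t *: dir i + x)) (h *: dir i) -
    u (t *: dir i + x))).
  apply/funext => h /=; congr (_ *: (u _ - _)).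
  by rewrite addrA -scalerDl [h *: 1]mulr1.
split; first by rewrite /derivable e.
by rewrite /derive e.
Qed.

Lemma increment_along u g x i (t e : R) : 0 < t ->
  (forall x, differentiable u x) -> (forall x, `|'D_(dir i) u x| <= g x) ->
  (forall s, 0 < s < t -> g (s *: dir i + x) <= g x + e) ->
  `|u (x + t *: dir i) - u x| <= t * (g x + e).
Proof.
move=> t0 du ug ge.
have [||s st] := @MVT R (fun s => u (s *: dir i + x))
  (fun s => 'D_(dir i) u (s *: dir i + x)) _ _ t0.
- by move=> s _; exact: is_derive_along.
- apply: continuous_subspaceT => s.
  apply: differentiable_continuous; apply/derivable1_diffP.
  exact: (@ex_derive _ _ _ _ _ _ _ (is_derive_along (du _))).
move=> /= H; rewrite [x + _]addrC (_ : u x = u (0 *: dir i + x)); last first.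
  by rewrite scale0r add0r.
rewrite H subr0 normrM (gtr0_norm t0) mulrC ler_wpM2l ?(ltW t0)//.
by apply: le_trans (ug _) _; apply: ge; move: st; rewrite in_itv.
Qed.

(** The upper half is the translate of the lower one by half a side, and it is
   reached in short steps.  On a step of length [t] the mean value theorem
   replaces the increment of [u] by [t * (g x + e')], the error [e'] coming from
   the uniform continuity of [g]; the translates of the lower half used on the
   way all lie in the box. *)
Lemma box_oscillation u g a l i : sides_gt0 l ->
  (forall x, differentiable u x) -> (forall x, `|'D_(dir i) u x| <= g x) ->
  continuous g ->
  `|boxint (a + (l ord0 i / 2) *: dir i) (halve i l) u - boxint a (halve i l) u|
  <= l ord0 i / 2 * boxint a l g.
Proof.
move=> l0 du ug cg; set h := l ord0 i / 2; set m := halve i l.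
have m0 : sides_gt0 m by exact: halve_gt0.
have h0 : 0 < h by rewrite divr_gt0.
have g0 x : 0 <= g x by exact: le_trans (ug x).
have cu : continuous u by move=> x; exact: differentiable_continuous.
have [K cK aK] := box_in_compact a l.
apply/ler_addgt0Pr => e e0.
have V0 : 0 < volume m by exact: volume_gt0.
have e'0 : 0 < e / (h * volume m) by rewrite divr_gt0// mulr_gt0.
set e' := e / (h * volume m) in e'0.
have [eta eta0 Heta] := compact_unif_continuous cK cg e'0.
pose B := boxint a l g + e' * volume m.
have step s t : 0 <= s -> 0 < t -> t < eta -> s + t <= h ->
    `|boxint (a + (s + t) *: dir i) m u - boxint (a + s *: dir i) m u| <= t * B.
  move=> s0 t0 teta sth.
  have sub : box (a + s *: dir i) m `<=` box a l.
    move=> x xQ j; have := xQ j; have := l0 j; rewrite !mxE eqxx /=.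
    by case: eqP => [->|_] /=; move: sth; rewrite /h => ? ? ?; lra.
  rewrite scalerDl addrA; move: (a + s *: dir i) sub => b sub.
  have cut : continuous (fun x => u (x + t *: dir i)).
    move=> x; apply: continuous_comp; last exact: cu.
    by apply: continuousD; [exact: cvg_id|exact: cst_continuous].
  rewrite boxint_shift// -boxintB//.
  have cd : continuous (fun x => u (x + t *: dir i) - u x).
    by move=> x; exact: (cvgB (cut x) (cu x)).
  apply: le_trans (normr_boxint _ m0 cd) _.
  have cge : continuous (fun x => g x + e').
    by move=> x; exact: (cvgD (cg x) (cvg_cst _)).
  apply: (@le_trans _ _ (boxint b m (fun x => t * (g x + e')))).
    apply: le_boxint => //.
    - by move=> x; exact: (cvg_norm (cd x)).
    - by move=> x; exact: (cvgM (cvg_cst _) (cge x)).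
    move=> x xQ; apply: increment_along => // r /andP[r0 rt].
    rewrite -lerBlDl; apply: le_trans (ler_norm _) _; apply/ltW/Heta.
      exact/aK/sub.
    rewrite addrK; apply: le_lt_trans (norm_dir_le _ _) _.
    by rewrite gtr0_norm// (lt_trans rt).
  rewrite boxintZ// boxintD//; last exact: cst_continuous.
  rewrite boxint_cst// ler_wpM2l ?(ltW t0)// lerD2r.
  exact: boxint_subset.
have iter N : (h / N.+1%:R < eta) -> forall k, (k <= N.+1)%N ->
    `|boxint (a + (k%:R * (h / N.+1%:R)) *: dir i) m u - boxint a m u|
    <= k%:R * (h / N.+1%:R) * B.
  move=> Neta; set t := h / _; have t0 : 0 < t by rewrite divr_gt0.
  elim=> [|k IH] kN.
    by rewrite !mul0r scale0r addr0 subrr normr0.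
  rewrite -natr1 mulrDl mul1r [leRHS]mulrDl.
  apply: le_trans (ler_distD (boxint (a + (k%:R * t) *: dir i) m u) _ _) _.
  rewrite addrC lerD// ?IH ?(ltnW kN)//; apply: step => //.
    by rewrite mulr_ge0// ltW.
  rewrite -[X in _ + X]mul1r -mulrDl natr1 /t mulrA ler_pdivrMr//.
  by rewrite mulrC ler_wpM2l ?(ltW h0)// ler_nat.
have [N Neta] : exists N : nat, h / N.+1%:R < eta.
  exists (Num.truncn (h / eta)); rewrite ltr_pdivrMr// mulrC -ltr_pdivrMr//.
  exact: truncnS_gt.
have := iter N Neta N.+1 (leqnn _).
rewrite mulrC divfK ?pnatr_eq0// => /le_trans; apply.
by rewrite /B mulrDr lerD2l /e' mulrCA divfK// gt_eqF// mulr_gt0.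
Qed.

(** The mean over the whole box is the average of the means over the halves, so
   each half is off by half of their distance. *)
Lemma mean_halve_dist u g a l i (b := a + (l ord0 i / 2) *: dir i) :
  sides_gt0 l ->
  (forall x, differentiable u x) -> (forall x, `|'D_(dir i) u x| <= g x) ->
  continuous g ->
  `|mean a (halve i l) u - mean a l u| <= l ord0 i / 2 * mean a l g /\
  `|mean b (halve i l) u - mean a l u| <= l ord0 i / 2 * mean a l g.
Proof.
move=> l0 du ug cg; have := box_oscillation a l0 du ug cg.
have cu : continuous u by move=> x; exact: differentiable_continuous.
have V0 := volume_gt0 l0.
rewrite !(mean_halve a i l0 cu) -/b.
set x := boxint b _ _; set y := boxint a _ u => xy.
have xy' : `|(volume l)^-1 * (x - y)| <= l ord0 i / 2 * mean a l g.
  rewrite normrM ger0_norm ?invr_ge0 ?(ltW V0)// /mean mulrCA.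
  by rewrite ler_wpM2l// invr_ge0 ltW.
rewrite /mean volume_halve -/x -/y invf_div; split.
  rewrite (_ : _ - _ = - ((volume l)^-1 * (x - y))) ?normrN; first exact: xy'.
  by field; rewrite gt_eqF.
rewrite (_ : _ - _ = (volume l)^-1 * (x - y)); first exact: xy'.
by field; rewrite gt_eqF.
Qed.

End oscillation.

(** * Jensen's inequality on boxes *)

Section power_of_continuous.
Context {R : realType} {n : nat}.
Implicit Types (a l x : 'rV[R]_n) (f g : 'rV[R]_n -> R).

(** The absolute value matters: [s `^ p] is [1] for [s < 0]. *)
Lemma continuous_normr_powR (p : R) : 0 < p -> continuous (fun t : R => `|t| `^ p).
Proof.
move=> p0 t; have [->|t0] := eqVneq t 0.
  apply/cvgrPdist_lt => e e0; rewrite normr0 powR0 ?gt_eqF//.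
  have d0 : 0 < e `^ p^-1 by rewrite powR_gt0.
  have ep : (e `^ p^-1) `^ p = e.
    by rewrite -powRrM mulVf ?gt_eqF// powRr1// ltW.
  apply: filterS (nbhsx_ballx (0 : R) _ d0) => s.
  rewrite -ball_normE /= sub0r normrN => se.
  rewrite sub0r normrN ger0_norm ?powR_ge0// -ep.
  by rewrite gt0_ltr_powR ?nnegrE// ltW.
have cp : {for `|t|, continuous (fun s : R => s `^ p)}.
  apply: differentiable_continuous; apply/derivable1_diffP.
  by apply: derivable_powR; rewrite in_itv /= andbT normr_gt0.
apply: (@cvg_comp _ _ _ Num.norm (fun s : R => s `^ p) _ _ _ _ cp).
exact: norm_continuous.
Qed.

Lemma continuous_normf f : continuous f -> continuous (fun x => `|f x|).
Proof. by move=> cf x; exact: (cvg_norm (cf x)). Qed.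

Lemma continuous_powR_norm (p : R) f : 0 < p -> continuous f ->
  continuous (fun x => `|f x| `^ p).
Proof.
move=> p0 cf x.
exact: (cvg_comp _ _ (cf x) (@continuous_normr_powR p p0 (f x))).
Qed.

Lemma continuous_powR_ge0 (p : R) f : 0 < p -> continuous f ->
  (forall x, 0 <= f x) -> continuous (fun x => f x `^ p).
Proof.
move=> p0 cf f0; rewrite (_ : (fun x => _) = (fun x => `|f x| `^ p)).
  exact: continuous_powR_norm.
by apply/funext => x; rewrite ger0_norm.
Qed.

(** Jensen's inequality, by integrating the supporting line of [t^p] at the
   mean of [f]. *)
Lemma mean_powR_le (p : R) f a l : 1 <= p -> sides_gt0 l -> continuous f ->
  (forall x, 0 <= f x) -> mean a l f `^ p <= mean a l (fun x => f x `^ p).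
Proof.
move=> p1 l0 cf f0; have p0 : 0 < p by lra.
have s0 := mean_ge0 a l0 f0; set s := mean a l f in s0 *.
have cfp := continuous_powR_ge0 p0 cf f0.
have ct : continuous (fun x => p * s `^ (p - 1) * f x).
  by move=> x; exact: (cvgM (cvg_cst _) (cf x)).
have cr : continuous (fun x => (p - 1) * s `^ p + f x `^ p).
  by move=> x; exact: (cvgD (cvg_cst _) (cfp x)).
have := le_mean (a := a) l0 ct cr (fun x _ => powR_young p1 s0 (f0 x)).
rewrite meanZ// meanD//; last exact: cst_continuous.
rewrite mean_cst// -/s -mulrA powR_split//.
lra.
Qed.

Lemma norm_mean_le f a l : sides_gt0 l -> continuous f ->
  `|mean a l f| <= mean a l (fun x => `|f x|).
Proof.
move=> l0 cf; have V0 := volume_gt0 l0.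
rewrite normrM ger0_norm ?invr_ge0 ?(ltW V0)// ler_wpM2l ?invr_ge0 ?(ltW V0)//.
exact: normr_boxint.
Qed.

End power_of_continuous.

(** * Balanced boxes *)

Section balanced_boxes.
Context {R : realType} {n : nat}.
Implicit Types (a l x : 'rV[R]_n) (i : 'I_n).

Definition balanced l := forall i j, l ord0 i <= 2 * l ord0 j.

Lemma longest_side l : (0 < n)%N -> exists i, forall j, l ord0 j <= l ord0 i.
Proof.
move=> n0; exists [arg max_(i > Ordinal n0) l ord0 i]%O => j.
by case: arg_maxP => // i _; apply.
Qed.

Lemma shortest_side l : (0 < n)%N -> exists i, forall j, l ord0 i <= l ord0 j.
Proof.
move=> n0; exists [arg min_(i < Ordinal n0) l ord0 i]%O => j.
by case: arg_minP => // i _; apply.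
Qed.

Lemma side_sum_le l (c : R) : (forall j, l ord0 j <= c) -> side_sum l <= n%:R * c.
Proof.
move=> lc; rewrite mulr_natl -[n in leRHS]card_ord -sumr_const.
exact: ler_sum.
Qed.

Lemma side_le_sum l i : sides_gt0 l -> l ord0 i <= side_sum l.
Proof.
move=> l0; rewrite /side_sum (bigD1 i)//= lerDl sumr_ge0// => j _; exact: ltW.
Qed.

Lemma side_sum_gt0 l : (0 < n)%N -> sides_gt0 l -> 0 < side_sum l.
Proof. by move=> n0 l0; apply: lt_le_trans (side_le_sum (Ordinal n0) l0). Qed.

(** Only a longest side may be cut: halving it produces a side that is no less
   than half of the others. *)
Lemma halve_balanced l i : sides_gt0 l -> balanced l ->
  (forall j, l ord0 j <= l ord0 i) -> balanced (halve i l).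
Proof.
move=> l0 lb li j k; have := lb j k; have := li j; have := l0 j; have := l0 k.
by rewrite !mxE; case: eqP => [->|_]; case: eqP => [->|_] ? ? ? ?; lra.
Qed.

(** In a balanced box every side is at least [side_sum l / (2 * n)]. *)
Lemma volume_lower_bound l : sides_gt0 l -> balanced l ->
  (side_sum l / (2 * n%:R)) ^+ n <= volume l.
Proof.
move=> l0 lb; rewrite -[n in _ ^+ n]card_ord -prodr_const.
apply: ler_prod => i _.
have n0 : (0 < n)%N by case: (n) i => [[]|].
apply/andP; split.
  by rewrite divr_ge0 ?mulr_ge0// ltW// side_sum_gt0.
rewrite ler_pdivrMr ?mulr_gt0 ?ltr0n//.
apply: le_trans (side_sum_le (lb^~ i)) _.
by rewrite mulrCA mulrA mulrC.
Qed.

End balanced_boxes.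

(** * A priori bound of the means at small scales *)

Section geometric.
Context {R : realType}.

Lemma geometric_unbounded (c M : R) : 0 < c -> exists N, M < (1 + c) ^+ N.
Proof.
move=> c0; exists (Num.truncn (M / c)).+1.
set N := _.+1; have bern k : 1 + k%:R * c <= (1 + c) ^+ k.
  elim: k => [|k IH]; first by rewrite mul0r addr0 expr0.
  rewrite exprS -natr1 mulrDl mul1r.
  apply: (@le_trans _ _ ((1 + c) * (1 + k%:R * c))); last first.
    by rewrite ler_wpM2l//; lra.
  have : 0 <= k%:R * (c * c) by rewrite mulr_ge0// mulr_ge0// ltW.
  by move: (k%:R : R) => x ?; nra.
have : M / c < N%:R by exact: truncnS_gt.
rewrite ltr_pdivrMr// => /lt_le_trans; apply; apply: le_trans (bern N).
by rewrite lerDr.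
Qed.

Lemma geometric_small (c M e : R) : 0 < c < 1 -> 0 < e ->
  exists N, M * (1 - c) ^+ N < e.
Proof.
move=> /andP[c0 c1] e0; have [N MN] := geometric_unbounded (M / e) c0.
exists N; move: MN; rewrite ltr_pdivrMr// => MN.
have P0 : 0 < (1 - c) ^+ N by rewrite exprn_gt0//; lra.
apply: lt_le_trans (_ : ((1 + c) ^+ N * e) * (1 - c) ^+ N <= _).
  by rewrite ltr_pM2r.
rewrite mulrAC -exprMn ler_piMl ?(ltW e0)// exprn_ile1//; nra.
Qed.

End geometric.

Section induction_on_scales.
Context {R : realType} {n : nat}.
Hypothesis n_gt0 : (0 < n)%N.
Variables u g : 'rV[R]_n -> R.
Hypothesis du : forall x, differentiable u x.
Hypothesis ug : forall i x, `|'D_(dir i) u x| <= g x.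
Hypothesis cg : continuous g.

Implicit Types (a l x : 'rV[R]_n) (i : 'I_n).

Let g_ge0 x : 0 <= g x.
Proof. exact: le_trans (normr_ge0 _) (ug (Ordinal n_gt0) x). Qed.

Let cu : continuous u.
Proof. by move=> x; exact: differentiable_continuous. Qed.

(** Doubling the shortest side leads from a small box up to a box of size one;
   the accumulated oscillation telescopes against the convex function
   [D^(- alpha)] of the total side length. *)
Lemma mean_bound_small_scale (alpha K G : R) : 0 < alpha -> 0 <= G ->
  (forall a l, sides_gt0 l -> balanced l -> 1 <= side_sum l ->
    `|mean a l u| <= K) ->
  (forall a l, sides_gt0 l -> balanced l ->
    mean a l g <= G * side_sum l `^ (- (alpha + 1))) ->
  forall a l, sides_gt0 l -> balanced l ->
    `|mean a l u| <= K + G / alpha * side_sum l `^ (- alpha).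
Proof.
move=> al0 G0 HK HG a l l0 lb.
have nR : 0 < n%:R :> R by rewrite ltr0n.
pose c : R := (2 * n%:R)^-1.
have c0 : 0 < c by rewrite invr_gt0 mulr_gt0.
have [N] := geometric_unbounded (side_sum l)^-1 c0.
have D0 := side_sum_gt0 n_gt0 l0.
rewrite -div1r ltr_pdivrMr// mulrC => /ltW.
elim: N l l0 lb D0 => [|N IH] l l0 lb D0.
  rewrite expr0 mulr1 => /(HK a l l0 lb) /le_trans; apply.
  by rewrite lerDl mulr_ge0 ?powR_ge0// divr_ge0// ltW.
have [i li] := shortest_side l n_gt0.
pose l' : 'rV[R]_n := \row_j (if j == i then 2 * l ord0 j else l ord0 j).
have hl' : halve i l' = l.
  by apply/rowP => j; rewrite !mxE; case: eqP => // _; field.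
have l'0 : sides_gt0 l' by move=> j; rewrite mxE; case: ifP; rewrite ?mulr_gt0.
have l'b : balanced l'.
  move=> j k; have := lb j k; have := lb j i; have := li k; have := l0 i.
  have := l0 k; have := l0 j; rewrite !mxE.
  by case: eqP => [->|_]; case: eqP => [->|_] ? ? ? ? ? ?; lra.
have l'i : l' ord0 i / 2 = l ord0 i by rewrite mxE eqxx; field.
have D' : side_sum l' = side_sum l + l ord0 i.
  by rewrite -hl' side_sum_halve l'i hl'; ring.
have D'0 := side_sum_gt0 n_gt0 l'0.
have lc : side_sum l * c <= l ord0 i.
  rewrite ler_pdivrMr ?mulr_gt0//.
  by rewrite mulrC -mulrA mulrCA; apply: side_sum_le => j; exact: lb.
rewrite exprS mulrA => DN.
have := IH l' l'0 l'b D'0; have -> : 1 <= side_sum l' * (1 + c) ^+ N.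
  apply: le_trans DN _; rewrite ler_wpM2r ?exprn_ge0 ?addr_ge0 ?(ltW c0)//.
  by rewrite D' mulrDr mulr1 lerD2l.
move=> /(_ isT) IH'.
have [] := mean_halve_dist a (i := i) l'0 du (ug i) cg.
rewrite hl' l'i => dist _.

have h1 : `|mean a l u| <= `|mean a l' u| + l ord0 i * mean a l' g.
  rewrite -lerBlDl; apply: le_trans dist; apply: lerB_dist.
have h2 : l ord0 i * mean a l' g <=
    G * (l ord0 i * side_sum l' `^ (- (alpha + 1))).
  by rewrite [leRHS]mulrCA ler_wpM2l ?(ltW (l0 i))// HG.
have := powRN_tangent (ltW al0) D'0 D0.
have -> : side_sum l' - side_sum l = l ord0 i by rewrite D'; ring.
move=> tan.
have := ler_wpM2l (divr_ge0 G0 (ltW al0)) tan.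
rewrite mulrDr (_ : G / alpha * (alpha * _ * _) =
  G * (l ord0 i * side_sum l' `^ (- (alpha + 1)))); last first.
  by field; rewrite gt_eqF.
move: h1 h2 IH'; lra.
Qed.

End induction_on_scales.

(** * Choice of the scale *)

Section choice_of_scale.
Context {R : realType}.
Implicit Types p b m t v : R.

Lemma ler_powRN b x y : 0 <= b -> 0 < x -> x <= y -> y `^ (- b) <= x `^ (- b).
Proof.
move=> b0 x0 xy; have y0 := lt_le_trans x0 xy.
rewrite !powRN lef_pV2 ?posrE ?powR_gt0//.
by rewrite ge0_ler_powR ?nnegrE// ltW.
Qed.

(** The optimal scale is [t = m^(-1/(1+b))], which balances [t^(- b)] and
   [t * m].  The lower bound on [m] keeps it below [T]; if it falls below [D], then
   [t = D] does at least as well. *)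
Lemma powR_le_of_scales p b K T D m v : 0 < p -> 0 < b -> 0 <= K ->
  0 < D -> D <= T -> T `^ (- (1 + b)) <= m -> 0 <= v ->
  (forall t, D <= t <= T -> v <= K * t `^ (- b) + (t - D) * m) ->
  v `^ (p * (1 + b^-1)) <= (K + 1) `^ (p * (1 + b^-1)) * m `^ p.
Proof.
move=> p0 b0 K0 D0 DT Tm v0 H; have T0 := lt_le_trans D0 DT.
have b10 : 0 < 1 + b by lra.
have m0 : 0 < m by apply: lt_le_trans Tm; rewrite powR_gt0.
pose t := m `^ (- (1 + b)^-1); have t0 : 0 < t by rewrite powR_gt0.
pose w := m `^ (b / (1 + b)); have w0 : 0 <= w by rewrite powR_ge0.
have tb : t `^ (- b) = w.
  by rewrite /t /w -powRrM; congr (_ `^ _); rewrite mulrNN mulrC.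
have tm : t * m = w.
  rewrite /w -[X in _ * X](powRr1 (ltW m0)) -powRD; last by rewrite (gt_eqF m0) implybT.
  by congr (_ `^ _); field; rewrite gt_eqF.
have tT : t <= T.
  have -> : T = (T `^ (- (1 + b))) `^ (- (1 + b)^-1).
    by rewrite -powRrM mulrNN mulfV ?gt_eqF// powRr1// ltW.
  by rewrite ler_powRN ?powR_gt0// invr_ge0 ltW.
have vw : v <= (K + 1) * w.
  have [tD|Dt] := leP t D.
    have /H : D <= D <= T by rewrite lexx.
    rewrite subrr mul0r addr0 => /le_trans; apply.
    apply: (@le_trans _ _ (K * w)); last by rewrite ler_wpM2r//; lra.
    by rewrite ler_wpM2l// -tb ler_powRN// ltW.
  have /H : D <= t <= T by rewrite (ltW Dt).
  rewrite tb mulrBl tm => /le_trans; apply.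
  have : 0 < D * m by rewrite mulr_gt0.
  lra.
set r := p * _; have r0 : 0 <= r by rewrite mulr_ge0 ?addr_ge0 ?invr_ge0 ?ltW.
apply: (@le_trans _ _ (((K + 1) * w) `^ r)).
  by rewrite ge0_ler_powR ?nnegrE// mulr_ge0//; lra.
rewrite powRM//; last by lra.
rewrite ler_wpM2l ?powR_ge0// /w -powRrM le_eqVlt; apply/orP; left; apply/eqP.
by congr (_ `^ _); rewrite /r; field; rewrite !gt_eqF.
Qed.

End choice_of_scale.

(** * Doob's inequality by bisection *)

Section bellman_induction.
Context {R : realType} {n : nat}.
Hypothesis n_gt0 : (0 < n)%N.
Variables u g : 'rV[R]_n -> R.
Hypothesis du : forall x, differentiable u x.
Hypothesis ug : forall i x, `|'D_(dir i) u x| <= g x.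
Hypothesis cg : continuous g.
Variables p b K T eps eta : R.
Hypotheses (p1 : 1 < p) (b0 : 0 < b) (K0 : 0 <= K) (eps0 : 0 <= eps).
Hypothesis mean_le : forall a l, sides_gt0 l -> balanced l ->
  `|mean a l u| <= K * side_sum l `^ (- b).
(* the boxes on which the bisection stops are those with [side_sum l < eta] *)
Hypothesis osc : forall a l x, sides_gt0 l -> side_sum l < eta -> box a l x ->
  `|u x| <= `|mean a l u| + eps.

Implicit Types (a l x : 'rV[R]_n) (i : 'I_n) (m : R).

Let g_ge0 x : 0 <= g x.
Proof. exact: le_trans (normr_ge0 _) (ug (Ordinal n_gt0) x). Qed.

Let cu : continuous u.
Proof. by move=> x; exact: differentiable_continuous. Qed.

Let r := p * (1 + b^-1).
Let K' := 2 `^ b * K.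
Let A := 2 `^ r * (K' + 1) `^ r * (2 / (p - 1)).

Let p0 : 0 < p. Proof. by move: p1; lra. Qed.
Let r0 : 0 < r. Proof. by rewrite mulr_gt0// addr_gt0// invr_gt0. Qed.
Let K'0 : 0 <= K'. Proof. by rewrite mulr_ge0// powR_ge0. Qed.
Let A0 : 0 <= A.
Proof. by rewrite !mulr_ge0 ?powR_ge0// invr_ge0 subr_ge0 ltW. Qed.

(** At scale [eta] the function [u] is its mean up to [eps], the mean is controlled
   by [m] through the choice of scale, and the loss between [m `^ p] and
   [doob p m] is paid by the energy of the box. *)
Lemma bellman_leaf a l m : sides_gt0 l -> side_sum l < eta -> side_sum l <= T ->
  T `^ (- (1 + b)) <= m ->
  (forall t, side_sum l <= t <= T ->
    `|mean a l u| <= K' * t `^ (- b) + (t - side_sum l) * m) ->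
  boxint a l (fun x => `|u x| `^ r) <=
    A * (volume l * doob p m (mean a l g) +
         2 `^ (p - 1) * boxint a l (fun x => g x `^ p)) +
    2 `^ r * eps `^ r * volume l.
Proof.
move=> l0 leta lT Tm H.
have V0 := volume_gt0 l0.
have m0 : 0 <= m by apply: le_trans Tm; exact: powR_ge0.
have s0 := mean_ge0 a l0 g_ge0.
have cgp := continuous_powR_ge0 p0 cg g_ge0.
set v := `|mean a l u| in H.
have h1 : boxint a l (fun x => `|u x| `^ r) <= (v + eps) `^ r * volume l.
  rewrite -(boxint_cst a)//; apply: le_boxint => //.
  - exact: continuous_powR_norm.
  - exact: cst_continuous.
  move=> x xQ; apply: ler_powR_base => //; first exact: ltW.
  exact: (osc l0 leta xQ).
have h2 : (v + eps) `^ r <= 2 `^ r * (v `^ r + eps `^ r).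
  by apply: le_powRD_max => //; [exact: ltW|exact: normr_ge0].
have h3 : v `^ r <= (K' + 1) `^ r * m `^ p.
  exact: (powR_le_of_scales p0 b0 K'0 (side_sum_gt0 n_gt0 l0) lT Tm (normr_ge0 _) H).
have h4 := powR_le_doob p1 m0 s0.
have h5 : volume l * mean a l g `^ p <= boxint a l (fun x => g x `^ p).
  rewrite -volume_mean// ler_wpM2l ?(ltW V0)//.
  by apply: mean_powR_le => //; exact: ltW.
apply: le_trans h1 _.
apply: (@le_trans _ _ (2 `^ r * ((K' + 1) `^ r * (2 / (p - 1) *
    (doob p m (mean a l g) + 2 `^ (p - 1) * mean a l g `^ p)) + eps `^ r) * volume l)).
  rewrite ler_wpM2r ?(ltW V0)//; apply: le_trans h2 _.
  rewrite ler_wpM2l ?powR_ge0// lerD2r; apply: le_trans h3 _.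
  by rewrite ler_wpM2l ?powR_ge0.
rewrite mulrDr [leLHS]mulrDl lerD2r.
rewrite (_ : _ * volume l = A * (volume l * doob p m (mean a l g) +
  2 `^ (p - 1) * (volume l * mean a l g `^ p))); last by rewrite /A; ring.
by rewrite ler_wpM2l// lerD2l ler_wpM2l// powR_ge0.
Qed.

(** Doob's function [doob p m s] is affine in [s], hence additive over the two
   halves of a box as long as the running maximum [m] is kept; updating [m]
   only decreases it.  The last hypothesis records that the mean of [u] can be
   compared with that of the ancestor of any size [t]; intermediate values of [t]
   cost the factor [2 `^ b] in [K'], since halving a side at most halves the sum. *)
Lemma bellman_induction N a l m : sides_gt0 l -> balanced l ->
  side_sum l * (1 - (2 * n%:R)^-1) ^+ N < eta -> side_sum l <= T ->
  T `^ (- (1 + b)) <= m -> mean a l g <= m ->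
  (forall t, side_sum l <= t <= T ->
    `|mean a l u| <= K' * t `^ (- b) + (t - side_sum l) * m) ->
  boxint a l (fun x => `|u x| `^ r) <=
    A * (volume l * doob p m (mean a l g) +
         2 `^ (p - 1) * boxint a l (fun x => g x `^ p)) +
    2 `^ r * eps `^ r * volume l.
Proof.
elim: N a l m => [|N IH] a l m l0 lb.
  by rewrite expr0 mulr1 => *; exact: bellman_leaf.
rewrite exprS mulrA => leta lT Tm sm H.
have nR : 0 < n%:R :> R by rewrite ltr0n.
have D0 := side_sum_gt0 n_gt0 l0.
have m0 : 0 <= m by apply: le_trans Tm; exact: powR_ge0.
have [i li] := longest_side l n_gt0.
set h := l ord0 i / 2; have h0 : 0 < h by rewrite divr_gt0.
set l' := halve i l; set c := a + h *: dir i.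
have l'0 : sides_gt0 l' by exact: halve_gt0.
have l'b : balanced l' by exact: halve_balanced.
have D'0 := side_sum_gt0 n_gt0 l'0.
have D'E : side_sum l' = side_sum l - h by exact: side_sum_halve.
have D'half : side_sum l <= 2 * side_sum l'.
  by rewrite D'E /h; have := side_le_sum i l0; lra.
have l'T : side_sum l' <= T by rewrite D'E; lra.
have l'eta : side_sum l' * (1 - (2 * n%:R)^-1) ^+ N < eta.
  apply: le_lt_trans leta; rewrite ler_wpM2r//.
    rewrite exprn_ge0// subr_ge0 invf_le1 ?mulr_gt0//.
    rewrite -natrM ler1n muln_gt0//.
  rewrite D'E mulrBr mulr1 lerD2l lerN2 ler_pdivrMr ?mulr_gt0//.
  by apply: le_trans (side_sum_le li) _; rewrite /h le_eqVlt; apply/orP; left;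
    apply/eqP; field.
have child e : `|mean e l' u - mean a l u| <= h * mean a l g ->
    boxint e l' (fun x => `|u x| `^ r) <=
    A * (volume l' * doob p m (mean e l' g) +
         2 `^ (p - 1) * boxint e l' (fun x => g x `^ p)) +
    2 `^ r * eps `^ r * volume l'.
  move=> dist; pose m' := Num.max m (mean e l' g).
  have mm' : m <= m' by rewrite le_max lexx.
  apply: le_trans (IH e l' m' l'0 l'b l'eta l'T _ _ _) _.
  - exact: le_trans Tm mm'.
  - by rewrite le_max lexx orbT.
  - move=> t /andP[Dt tT].
    (* below the size of the parent there is no ancestor to compare with, and
       [mean_le] on the child itself is strong enough *)
    have [tD|Dt'] := ltP t (side_sum l).
      apply: le_trans (mean_le _ l'0 l'b) _.
      apply: (@le_trans _ _ (K' * t `^ (- b))); last first.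
        by rewrite lerDl mulr_ge0// ?subr_ge0// (le_trans m0).
      have t0 : 0 < t by exact: lt_le_trans Dt.
      rewrite /K' -mulrA mulrCA ler_wpM2l//.
      have -> : 2 `^ b * t `^ (- b) = (t / 2) `^ (- b).
        rewrite powRM ?invr_ge0 ?(ltW t0)// mulrC -[2^-1]powR_inv1// -powRrM.
        by rewrite mulrNN mul1r.
      by rewrite ler_powRN ?divr_gt0 ?(ltW b0)//; lra.
    have uQ : `|mean a l u| <= K' * t `^ (- b) + (t - side_sum l) * m.
      by apply: H; rewrite Dt'.
    have uQ' : `|mean e l' u| <= `|mean a l u| + h * m.
      rewrite -lerBlDl; apply: le_trans (lerB_dist _ _) _.
      by apply: le_trans dist _; rewrite ler_wpM2l// ltW.
    have : (t - side_sum l') * m <= (t - side_sum l') * m'.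
      by rewrite ler_wpM2l// subr_ge0.
    move: uQ uQ'; rewrite D'E; lra.
  rewrite lerD2r ler_wpM2l// lerD2r ler_wpM2l ?(ltW (volume_gt0 l'0))//.
  apply: doob_update => //; [exact: ltW|exact: mean_ge0].
have [dista distc] := mean_halve_dist a (i := i) l0 du (ug i) cg.
have cgp := continuous_powR_ge0 p0 cg g_ge0.
have cur := continuous_powR_norm r0 cu.
rewrite (boxint_halve a i l0 cur) -/h -/c -/l'.
apply: le_trans (lerD (child a dista) (child c distc)) _.
rewrite (boxint_halve a i l0 cgp) -/h -/c -/l' (mean_halve a i l0 cg) -/h -/c -/l'.
rewrite (volume_halve l i) /doob.
by rewrite le_eqVlt; apply/orP; left; apply/eqP; field.
Qed.

End bellman_induction.

(** * Euclidean balls and power integrals *)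

Section euclidean_norm.
Context {R : realType} {n : nat}.
Implicit Types (v x z : 'rV[R]_n) (u : 'rV[R]_n -> R).

Lemma coord_le_enorm v i : `|v ord0 i| <= enorm v.
Proof.
rewrite -sqrtr_sqr /enorm ler_wsqrtr// (bigD1 i)//= lerDl.
by rewrite sumr_ge0// => j _; exact: sqr_ge0.
Qed.

Lemma enorm_le_sum v : (forall i, 0 <= v ord0 i) ->
  enorm v <= \sum_i v ord0 i.
Proof.
move=> v0; have s0 : 0 <= \sum_i v ord0 i by exact: sumr_ge0.
rewrite /enorm -[leRHS]ger0_norm// -sqrtr_sqr ler_wsqrtr//.
rewrite expr2 mulr_suml; apply: ler_sum => i _.
by rewrite expr2 ler_wpM2l// (bigD1 i)//= lerDl sumr_ge0.
Qed.

Lemma continuous_enorm : continuous (@enorm R n).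
Proof.
have cs : continuous (fun v : 'rV[R]_n => \sum_i v ord0 i ^+ 2).
  apply: continuous_big => [|i _ v]; first exact: add_continuous.
  have := @coord_continuous R 1 n ord0 i v => cv.
  exact: (cvgM cv cv).
move=> v; exact: (cvg_comp _ _ (cs v) (@sqrt_continuous R _)).
Qed.

Lemma measurable_eball z (rho : R) : measurable (eball z rho).
Proof.
have cf : continuous (fun y : 'rV[R]_n => enorm (y - z)).
  move=> y; apply: continuous_comp; last exact: continuous_enorm.
  by apply: continuousB; [exact: cvg_id|exact: cst_continuous].
have -> : eball z rho = (fun y : 'rV[R]_n => enorm (y - z)) @^-1` `]-oo, rho[%classic.
  by apply/seteqP; split => y /=; rewrite in_itv.
rewrite -[X in measurable X]setTI.
by apply: (continuous_measurable_rV cf).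
Qed.

Lemma box_sub_eball (a l : 'rV[R]_n) : (0 < n)%N ->
  box a l `<=` eball a (side_sum l).
Proof.
move=> n0 y ya; rewrite /eball /=; apply: le_lt_trans (enorm_le_sum _) _.
  by move=> i; have := ya i; rewrite !mxE => ?; lra.
rewrite /side_sum; apply: ltr_sum => [|i _].
  by apply/hasP; exists (Ordinal n0); rewrite ?mem_index_enum.
by have := ya i; rewrite !mxE => ?; lra.
Qed.

End euclidean_norm.

Section means_from_power_integrals.
Context {R : realType} {n : nat}.
Hypothesis n_gt0 : (0 < n)%N.

(** Jensen's inequality, with the volume of the box bounded below by a power of
   its size.  It serves for the gradient, with [beta = 0], and for the Morrey
   condition. *)
Lemma mean_le_of_power (s beta : R) (f : 'rV[R]_n -> R) a l :
  1 <= s -> sides_gt0 l -> balanced l -> continuous f -> (forall x, 0 <= f x) ->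
  boxint a l (fun x => f x `^ s) <= side_sum l `^ beta ->
  mean a l f <= (2 * n%:R) `^ (n%:R / s) * side_sum l `^ ((beta - n%:R) / s).
Proof.
move=> s1 l0 lb cf f0 fs; have s0 : 0 < s by lra.
have nR : 0 < n%:R :> R by rewrite ltr0n.
have D0 := side_sum_gt0 n_gt0 l0; have V0 := volume_gt0 l0.
have m0 := mean_ge0 a l0 f0.
have N0 : 0 <= 2 * n%:R :> R by rewrite mulr_ge0.
have h1 : mean a l f `^ s <= (2 * n%:R) `^ n%:R * side_sum l `^ (beta - n%:R).
  apply: le_trans (mean_powR_le a s1 l0 cf f0) _.
  rewrite /mean ler_pdivrMl//; apply: le_trans fs _.
  have -> : side_sum l `^ beta =
      (side_sum l / (2 * n%:R)) ^+ n *
      ((2 * n%:R) `^ n%:R * side_sum l `^ (beta - n%:R)).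
    rewrite powR_mulrn// mulrA -exprMn divfK ?gt_eqF ?mulr_gt0//.
    rewrite -powR_mulrn ?(ltW D0)// -powRD; last by rewrite (gt_eqF D0) implybT.
    by congr (_ `^ _); ring.
  rewrite ler_wpM2r ?mulr_ge0 ?powR_ge0//.
  exact: volume_lower_bound.
have sn0 : s != 0 by rewrite gt_eqF.
rewrite -[leLHS](powRr1 m0) -[X in _ `^ X <= _](mulfV sn0) powRrM.
rewrite !(powRrM _ _ s^-1) -powRM ?powR_ge0//.
apply: ler_powR_base; [by rewrite invr_ge0 ltW|exact: powR_ge0|exact: h1].
Qed.

End means_from_power_integrals.

(** * Functions with compact support *)

Section compact_support.
Context {R : realType} {n : nat}.
Implicit Types (u f : 'rV[R]_n -> R) (x y a l : 'rV[R]_n).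

Lemma coord_le_norm x i : `|x ord0 i| <= `|x|.
Proof.
by rewrite [leRHS]/Num.norm /= mx_normrE; apply/bigmax_geP; right; exists (ord0, i).
Qed.

Lemma norm_lt_coord x (e : R) : 0 < e -> (forall i, `|x ord0 i| < e) -> `|x| < e.
Proof.
move=> e0 H; rewrite [ltLHS]/Num.norm /= mx_normrE.
by apply/bigmax_ltP; split => // -[j k] _ /=; rewrite ord1.
Qed.

Lemma supported_unif_continuous u (e : R) : continuous u ->
  compact (closure [set x | u x != 0]) -> 0 < e ->
  exists2 eta, 0 < eta & forall x y, `|y - x| < eta -> `|u y - u x| <= e.
Proof.
move=> cu cK e0; have [eta eta0 H] := compact_unif_continuous cK cu e0.
exists eta => // x y xy.
have [ux|/eqP ux] := eqVneq (u x) 0; last first.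
  apply/ltW/H => //; apply: subset_closure; exact/eqP.
have [uy|/eqP uy] := eqVneq (u y) 0; first by rewrite ux uy subrr normr0 ltW.
rewrite distrC; apply/ltW/H; last by rewrite distrC.
by apply: subset_closure; exact/eqP.
Qed.

Lemma norm_le_mean u (e eta : R) a l x : continuous u -> sides_gt0 l ->
  (forall x y, `|y - x| < eta -> `|u y - u x| <= e) ->
  side_sum l < eta -> box a l x -> `|u x| <= `|mean a l u| + e.
Proof.
move=> cu l0 H leta xQ; have V0 := volume_gt0 l0.
have near_x y : box a l y -> u x - e <= u y <= u x + e.
  move=> yQ; suff : `|u y - u x| <= e by rewrite ler_norml => ?; lra.
  have D0 : 0 <= side_sum l by apply: sumr_ge0 => i _; exact: ltW.
  apply/H/norm_lt_coord => [|i]; first exact: le_lt_trans leta.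
  rewrite !mxE ltr_norml; have := yQ i; have := xQ i; have := side_le_sum i l0.
  by move=> ? ? ?; lra.
have m1 : u x - e <= mean a l u.
  rewrite -(mean_cst a (u x - e) l0); apply: le_mean => //.
    exact: cst_continuous.
  by move=> y /near_x /andP[].
have m2 : mean a l u <= u x + e.
  rewrite -(mean_cst a (u x + e) l0); apply: le_mean => //.
    exact: cst_continuous.
  by move=> y /near_x /andP[].
have : `|u x - mean a l u| <= e by rewrite ler_norml; lra.
by have := lerB_dist (u x) (mean a l u) => ? ?; lra.
Qed.

Lemma supported_in_cube u : compact (closure [set x | u x != 0]) ->
  exists2 L : R, 1 <= L &
    forall x, u x != 0 -> forall i, - L <= x ord0 i < - L + 2 * L.
Proof.
move=> /compact_bounded[M [Mreal HM]].
have M1 : 1 <= Num.max M 1 by rewrite le_max lexx orbT.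
have MM : M <= Num.max M 1 by rewrite le_max lexx.
exists (Num.max M 1 + 1) => [|x ux i]; first by lra.
have xS : closure [set x | u x != 0] x by exact: subset_closure.
have /HM/(_ x xS) /= xM : M < Num.max M 1 + 1 / 2 by lra.
have := le_trans (coord_le_norm x i) xM; rewrite ler_norml => ?.
lra.
Qed.

Lemma integral_supported_box f a l : sides_gt0 l -> continuous f ->
  (forall x, f x != 0 -> box a l x) ->
  (\int[lebesgue_rV n]_x (f x)%:E)%E = (boxint a l f)%:E.
Proof.
move=> l0 cf fQ; rewrite boxint_EFin// [RHS]integral_mkcond.
apply: eq_integral => x _; rewrite patchE; case: ifPn => // xQ.
by congr EFin; apply/eqP; apply: contraNT xQ => /fQ; exact: mem_set.
Qed.

End compact_support.

Section energy_bounds.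
Context {R : realType} {n : nat}.
Hypothesis n_gt0 : (0 < n)%N.

Lemma boxint_le_integral (f : 'rV[R]_n -> R) (E : set 'rV[R]_n) (c : R) a l :
  measurable E -> box a l `<=` E ->
  sides_gt0 l -> continuous f -> (forall x, 0 <= f x) ->
  (\int[lebesgue_rV n]_(x in E) (f x)%:E <= c%:E)%E -> boxint a l f <= c.
Proof.
move=> mE sub l0 cf f0 fc; rewrite -lee_fin boxint_EFin//; apply: le_trans fc.
apply: ge0_subset_integral => //; first exact: measurable_box.
- by apply/measurable_EFinP/measurable_funTS; exact: continuous_measurable_rV.
- by move=> x _; rewrite lee_fin.
Qed.

(** A box lies in the Euclidean ball centred at its lower corner whose radius is
   the sum of the sides. *)
Lemma morrey_boxint (s q1 : R) (u : 'rV[R]_n -> R) a l :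
  1 <= q1 -> continuous u -> sides_gt0 l ->
  (ereal_sup
     [set (rhoz.1 `^ s)%:E *
          \int[lebesgue_rV n]_(x in eball rhoz.2 rhoz.1) (`|u x| `^ q1)%:E
     | rhoz in [set rhoz : R * 'rV[R]_n | (0 < rhoz.1)%R]] <= 1)%E ->
  boxint a l (fun x => `|u x| `^ q1) <= side_sum l `^ (- s).
Proof.
move=> q11 cu l0 H; have D0 := side_sum_gt0 n_gt0 l0.
have q10 : 0 < q1 by lra.
have P0 : 0 < side_sum l `^ s by exact: powR_gt0.
apply: (@boxint_le_integral _ (eball a (side_sum l))) => //.
- exact: measurable_eball.
- exact: box_sub_eball.
- exact: continuous_powR_norm.
have : ((side_sum l `^ s)%:E *
  \int[lebesgue_rV n]_(x in eball a (side_sum l)) (`|u x| `^ q1)%:E <= 1)%E.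
  apply: le_trans H; apply: ereal_sup_ubound.
  by exists (side_sum l, a).
by rewrite powRN -lee_pdivlMl// mule1.
Qed.

End energy_bounds.

Lemma grad_coord_le (R : realType) (n : nat) (u : 'rV[R]_n -> R) i x :
  `|'D_(dir i) u x| <= enorm (grad u x).
Proof. by have := coord_le_enorm (grad u x) i; rewrite mxE. Qed.

(** * The estimate with explicit constant *)

Section main_estimate.
Context {R : realType} {d : nat}.
Hypothesis d_gt0 : (0 < d)%N.
Variables p q q1 r : R.
Hypothesis hp : 1 < p < d%:R.
Hypothesis hq : 0 < q.
Hypothesis hq1 : 1 <= q1.
Hypothesis hr : p * (q / d%:R + 1) <= r <= p * d%:R / (d%:R - p).

Let b := p / (r - p).
Let alpha := d%:R / p - 1.
Let G : R := (2 * d%:R) `^ (d%:R / p).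
Let K1 : R := (2 * d%:R) `^ (d%:R / q1).
Let K : R := K1 + G / alpha.
Let A : R := 2 `^ r * (2 `^ b * K + 1) `^ r * (2 / (p - 1)).

Definition energy_constant : R := A * ((p - 1) + 2 `^ (p - 1)) + 1.

Let p1 : 1 < p. Proof. by case/andP: hp. Qed.
Let p0 : 0 < p. Proof. by move: p1; lra. Qed.
Let pd : p < d%:R. Proof. by case/andP: hp. Qed.
Let dR : 0 < d%:R :> R. Proof. by rewrite ltr0n. Qed.
Let q10 : 0 < q1. Proof. by move: hq1; lra. Qed.

Let rp : p * q / d%:R <= r - p.
Proof.
case/andP: hr => h _; rewrite lerBrDr; apply: le_trans h.
by rewrite mulrDr mulr1 mulrA.
Qed.

Let rp0 : 0 < r - p.
Proof. by apply: lt_le_trans rp; rewrite divr_gt0// mulr_gt0. Qed.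

Let b0 : 0 < b. Proof. by rewrite divr_gt0. Qed.

Let alpha0 : 0 < alpha.
Proof. by rewrite subr_gt0 ltr_pdivlMr// mul1r. Qed.

Let rE : p * (1 + b^-1) = r.
Proof. by rewrite /b; field; rewrite !gt_eqF. Qed.

(* equivalent to the lower bound on [r] *)
Let b_le : b <= d%:R / q.
Proof.
rewrite ler_pdivrMr// mulrAC ler_pdivlMr// mulrC.
by move: rp; rewrite ler_pdivrMr// mulrC [_ * d%:R]mulrC.
Qed.

(* equivalent to the upper bound on [r] *)
Let alpha_le : alpha <= b.
Proof.
have dp : 0 < d%:R - p by rewrite subr_gt0.
rewrite ler_pdivlMr//.
have -> : alpha * (r - p) = (d%:R - p) * r / p - (d%:R - p).
  by rewrite /alpha; field; rewrite gt_eqF.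
rewrite lerBlDr ler_pdivrMr//.
case/andP: hr => _; rewrite ler_pdivlMr// mulrC => /le_trans; apply.
by rewrite subrKC mulrC.
Qed.

Let G0 : 0 <= G. Proof. exact: powR_ge0. Qed.
Let K10 : 0 <= K1. Proof. exact: powR_ge0. Qed.
Let K0 : 0 <= K. Proof. by rewrite addr_ge0// divr_ge0// ltW. Qed.

Lemma energy_constant_gt0 : 0 < energy_constant.
Proof.
have A0 : 0 <= A by rewrite !mulr_ge0 ?powR_ge0// invr_ge0 subr_ge0 ltW.
rewrite ltr_wpDl// mulr_ge0// addr_ge0 ?powR_ge0//.
by move: p1; lra.
Qed.

Section estimate.
Variable u : 'rV[R]_d -> R.
Hypothesis hu : C1c u.
Hypothesis energy : (\int[lebesgue_rV d]_x (enorm (grad u x) `^ p)%:E <= 1)%E.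
Hypothesis morrey : (ereal_sup
  [set (rhoz.1 `^ (d%:R * (q1 - q) / q))%:E *
       \int[lebesgue_rV d]_(x in eball rhoz.2 rhoz.1) (`|u x| `^ q1)%:E
  | rhoz in [set rhoz : R * 'rV[R]_d | (0 < rhoz.1)%R]] <= 1)%E.

Let g x := enorm (grad u x).

Let du x : differentiable u x. Proof. by case: hu. Qed.
Let cu : continuous u. Proof. by move=> x; exact: differentiable_continuous. Qed.
Let cg : continuous g.
Proof.
case: hu => _ cgu _ x.
exact: (cvg_comp _ _ (cgu x) (@continuous_enorm R d _)).
Qed.
Let g0 x : 0 <= g x. Proof. exact: sqrtr_ge0. Qed.

Let mean_u_le a l : sides_gt0 l -> balanced l ->
  `|mean a l u| <= K1 * side_sum l `^ (- (d%:R / q)).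
Proof.
move=> l0 lb; apply: le_trans (norm_mean_le a l0 cu) _.
have cnu := continuous_normf cu.
have := mean_le_of_power d_gt0 hq1 l0 lb cnu (fun x => normr_ge0 _)
  (morrey_boxint d_gt0 a hq1 cu l0 morrey).
congr (_ <= _ * _ `^ _).
by field; rewrite !gt_eqF.
Qed.

Let energy_box a l : sides_gt0 l -> boxint a l (fun x => g x `^ p) <= 1.
Proof.
move=> l0; apply: (boxint_le_integral (E := setT)) => //.
- exact: continuous_powR_ge0.
- by move=> x; exact: powR_ge0.
Qed.

Let mean_g_le a l : sides_gt0 l -> balanced l ->
  mean a l g <= G * side_sum l `^ (- (alpha + 1)).
Proof.
move=> l0 lb; have := @mean_le_of_power R d d_gt0 p 0 g a l (ltW p1) l0 lb cg g0.
rewrite powRr0 => /(_ (energy_box a l0)); congr (_ <= _ * _ `^ _).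
by rewrite /alpha; field; rewrite gt_eqF.
Qed.

Let mean_u_scale a l : sides_gt0 l -> balanced l ->
  `|mean a l u| <= K * side_sum l `^ (- b).
Proof.
move=> l0 lb; have D0 := side_sum_gt0 d_gt0 l0.
have dq0 : 0 <= d%:R / q by rewrite divr_ge0// ltW.
have [D1|D1] := leP 1 (side_sum l).
  apply: le_trans (mean_u_le a l0 lb) _; apply: ler_pM; rewrite ?powR_ge0//.
    by rewrite lerDl divr_ge0// ltW.
  by apply: ler_powR; rewrite ?lerN2 ?b_le.
have unit_scale e m : sides_gt0 m -> balanced m -> 1 <= side_sum m ->
    `|mean e m u| <= K1.
  move=> m0 mb m1; apply: le_trans (mean_u_le e m0 mb) _.
  rewrite -[leRHS]mulr1 ler_wpM2l//.
  by rewrite -[leRHS](powRr0 (side_sum m)) ler_powR// oppr_le0.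
apply: le_trans (mean_bound_small_scale d_gt0 du (grad_coord_le u) cg alpha0 G0
  unit_scale mean_g_le a l0 lb) _.
have mono c : c <= b -> side_sum l `^ (- c) <= side_sum l `^ (- b).
  by move=> cb; apply: ger_powR; rewrite ?lerN2// D0 ltW.
rewrite mulrDl lerD//; last first.
  by rewrite ler_wpM2l ?mono// divr_ge0// ltW.
rewrite -[leLHS]mulr1 ler_wpM2l//.
by have := mono 0 (ltW b0); rewrite oppr0 powRr0.
Qed.

(** The induction is run on a cube of side [2 * L] containing the support, to a
   depth given by the modulus of continuity of [u]; neither enters the constant. *)
Lemma energy_estimate :
  (\int[lebesgue_rV d]_x (`|u x| `^ r)%:E <= energy_constant%:E)%E.
Proof.
have [_ _ cK] := hu.
have [L L1 HL] := supported_in_cube cK.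
pose a : 'rV[R]_d := const_mx (- L); pose l : 'rV[R]_d := const_mx (2 * L).
have l0 : sides_gt0 l by move=> i; rewrite mxE; lra.
have lb : balanced l by move=> i j; rewrite !mxE; lra.
have V0 := volume_gt0 l0; have T0 := side_sum_gt0 d_gt0 l0.
have r0 : 0 < r by move: rp0 p0; lra.
have cur := continuous_powR_norm r0 cu.
rewrite (@integral_supported_box _ _ _ a l)//; last first.
  move=> x ux i; rewrite !mxE; apply: HL.
  by apply: contraNneq ux => ->; rewrite normr0 powR0// gt_eqF.
rewrite lee_fin.
(* chosen so that the error terms of all the final boxes add up to 1 *)
pose eps := (2 `^ r * volume l) `^ (- r^-1).
have epsr : eps `^ r = (2 `^ r * volume l)^-1.
  rewrite /eps -powRrM mulNr mulVf ?gt_eqF// powR_inv1//.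
  by rewrite mulr_ge0 ?powR_ge0// ltW.
have eps0 : 0 < eps by rewrite powR_gt0// mulr_gt0// powR_gt0.
have [eta eta0 Heta] := supported_unif_continuous cu cK eps0.
have c01 : 0 < (2 * d%:R : R)^-1 < 1.
  rewrite invr_gt0 mulr_gt0//= invf_lt1 ?mulr_gt0//.
  by rewrite -natrM ltr1n; exact: leq_pmulr.
have [N HN] := geometric_small (side_sum l) c01 eta0.
set T := side_sum l in T0 HN.
pose m0 := T `^ (- (1 + b)); pose m := Num.max m0 (mean a l g).
have m00 : 0 <= m0 by exact: powR_ge0.
have osc e k x : sides_gt0 k -> side_sum k < eta -> box e k x ->
    `|u x| <= `|mean e k u| + eps.
  by move=> k0 keta; exact: (norm_le_mean cu k0 Heta keta).
have := @bellman_induction R d d_gt0 u g du (grad_coord_le u) cg p b K T eps eta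
  p1 b0 K0 (ltW eps0) mean_u_scale osc N a l m l0 lb HN (lexx _) _ _ _.
rewrite rE -/A => H.
apply: le_trans (H _ _ _) _.
- by rewrite le_max lexx.
- by rewrite le_max lexx orbT.
- move=> t /andP[Tt tT]; have -> : t = T by apply/eqP; rewrite eq_le tT Tt.
  rewrite subrr mul0r addr0; apply: le_trans (mean_u_scale a l0 lb) _.
  rewrite ler_wpM2r ?powR_ge0// -[leLHS]mul1r ler_wpM2r//.
  by rewrite -[leLHS](powRr0 2) ler_powR// ?ler1n// ltW.
have A0 : 0 <= A by rewrite !mulr_ge0 ?powR_ge0// invr_ge0 subr_ge0 ltW.
rewrite epsr /energy_constant; apply: lerD; last first.
  rewrite invfM mulrA mulfV ?gt_eqF ?powR_gt0// mul1r mulVf// gt_eqF//.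
rewrite ler_wpM2l//; apply: lerD; last first.
  by rewrite -[leRHS]mulr1 ler_wpM2l ?powR_ge0// energy_box.
have s0 : 0 <= mean a l g by exact: mean_ge0.
apply: (@le_trans _ _ (volume l * ((p - 1) * m0 `^ p))).
  rewrite ler_wpM2l ?(ltW V0)//.
  by apply: le_trans (doob_update (ltW p1) m00 s0) (doob_le (ltW p1) m00 s0).
rewrite mulrCA -[leRHS]mulr1 ler_wpM2l ?subr_ge0 ?(ltW p1)//.
(* [volume l <= T ^ d] and [d <= p * (1 + b)], so the size of the cube cancels *)
have TE : T = d%:R * (2 * L).
  rewrite /T /side_sum; under eq_bigr do rewrite mxE.
  by rewrite sumr_const card_ord [RHS]mulr_natl.
have d1 : 1 <= d%:R :> R by rewrite ler1n.
have LT : 2 * L <= T by rewrite TE ler_peMl//; lra.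
have T1 : 1 <= T by lra.
have VT : volume l <= T `^ d%:R.
  rewrite powR_mulrn ?(ltW T0)// -[d in leRHS]card_ord -prodr_const.
  by apply: ler_prod => i _; rewrite mxE LT; lra.
apply: le_trans (ler_wpM2r (powR_ge0 _ _) VT) _.
rewrite /m0 -powRrM -powRD; last by rewrite (gt_eqF T0) implybT.
rewrite -[leRHS](powRr0 T) ler_powR//.
have : d%:R <= (1 + b) * p.
  by have := alpha_le; rewrite /alpha lerBlDl ler_pdivrMr.
lra.
Qed.

End estimate.
End main_estimate.

Theorem theorem2p2 (R : realType) (d : nat) (p q q1 : R)
    (hd : (2 <= d)%N)
    (hp : 1 < p < d%:R)
    (hq : 1 < q < p * d%:R / (d%:R - p))
    (hq1 : 1 <= q1 <= q) :
  forall r : R, p * (q / d%:R + 1) <= r <= p * d%:R / (d%:R - p) ->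
  exists C : R, 0 < C /\
    forall u : 'rV[R]_d -> R, C1c u ->
      (\int[lebesgue_rV d]_x (enorm (grad u x) `^ p)%:E <= 1)%E ->
      (ereal_sup
         [set (rhoz.1 `^ (d%:R * (q1 - q) / q))%:E *
              \int[lebesgue_rV d]_(x in eball rhoz.2 rhoz.1) (`|u x| `^ q1)%:E
         | rhoz in [set rhoz : R * 'rV[R]_d | (0 < rhoz.1)%R]] <= 1)%E ->
      (\int[lebesgue_rV d]_x (`|u x| `^ r)%:E <= C%:E)%E.
Proof.
move=> r hr; have d0 : (0 < d)%N by exact: ltnW.
case/andP: hq hq1 => q_gt1 _ /andP[q1_ge1 _].
have q0 : 0 < q by apply: lt_trans q_gt1.
exists (energy_constant p q1 r (d := d)); split.
  exact: energy_constant_gt0.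
move=> u hu energy morrey.
exact: (energy_estimate d0 hp q0 q1_ge1 hr hu energy morrey).
Qed.
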